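(* For all $A,B,C\in\mathbb R$ and all $t\in\mathbb R$, $$\big\langle\Phi,e^{it(A(\sqrt2q)^2+B(\sqrt2q)+C(\sqrt2p))}\Phi\big\rangle=(1-2itA)^{-\frac12}\exp\left(\frac{4C^2(A^2t^4+2iAt^3)-3|M|^2t^2}{6(1-2iAt)}\right),$$ where $M=B+iC$.
   Context: On $L^2(\mathbb R)$ the position and momentum operators are $(q\varphi)(x)=x\varphi(x)$ and $(p\varphi)(x)=\frac1i\frac{\partial}{\partial x}\varphi(x)$. $\Phi\in L^2(\mathbb R)$ is the Fock vacuum vector, $\Phi(x)=\pi^{-1/4}e^{-x^2/2}$, so that in the state $\Phi$ the operator $\sqrt2\,q$ has the standard Gaussian distribution $\mathcal N(0,1)$. For real $a,b,c$ the operator $aq^2+bq+cp$ is essentially self-adjoint on $C_c^\infty(\mathbb R)$ and $e^{i(aq^2+bq+cp)}$ is the unitary operator obtained by exponentiating its closure. The square root $(1-2itA)^{-1/2}$ is the principal branch. *)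

(* Defs.v *)
From HB Require Import structures.
From mathcomp Require Import all_boot all_order all_algebra.
From mathcomp Require Import all_classical all_reals all_analysis.
From mathcomp Require Export complex.

Set Implicit Arguments.
Unset Strict Implicit.
Unset Printing Implicit Defensive.

Import Order.TTheory GRing.Theory Num.Theory.
Import numFieldNormedType.Exports.

Local Open Scope classical_set_scope.
Local Open Scope ring_scope.
Local Open Scope complex_scope.

(* Elements of L^2(R) are handled through representatives: functions R -> R[i]
   with Borel real and imaginary parts and finite L^2-norm, two of which denote
   the same vector when they agree almost everywhere. *)
Definition wavefun (R : realType) := R -> R[i].

Definition L2norm (R : realType) (f : wavefun R) : \bar R :=
  Lnorm (@lebesgue_measure R) 2%:E (fun x => (complex.ComplexField.Normc.normc (f x))%:E).

Definition L2 (R : realType) : set (wavefun R) :=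
  [set f | [/\ measurable_fun setT (fun x => complex.Re (f x)),
               measurable_fun setT (fun x => complex.Im (f x)) &
               (L2norm f < +oo)%E]].

Definition L2eq (R : realType) (f g : wavefun R) : Prop :=
  {ae @lebesgue_measure R, forall x, f x = g x}.

(* antilinear in the first argument *)
Definition inner (R : realType) (f g : wavefun R) : R[i] :=
  (Rintegral (@lebesgue_measure R) setT (fun x => complex.Re (conjc (f x) * g x))) +i*
  (Rintegral (@lebesgue_measure R) setT (fun x => complex.Im (conjc (f x) * g x))).

Definition operator (R : realType) := wavefun R -> wavefun R.

Definition position (R : realType) : operator R := fun f x => x%:C * f x.

Definition momentum (R : realType) : operator R := fun f x =>
  'i%C^-1 * (derive1 (fun y => complex.Re (f y)) x +i*
             derive1 (fun y => complex.Im (f y)) x).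

Definition scaleop (R : realType) (a : R) (T : operator R) : operator R :=
  fun f x => a%:C * T f x.

Definition addop (R : realType) (S T : operator R) : operator R :=
  fun f x => S f x + T f x.

Definition smooth (R : realType) (f : R -> R) : Prop :=
  forall n x, derivable (derive1n n f) x 1.

Definition Cc_infty (R : realType) : set (wavefun R) :=
  [set f | [/\ smooth (fun x => complex.Re (f x)), smooth (fun x => complex.Im (f x)) &
               compact (closure [set x | f x != 0])]].

(* Partially defined operators are given by their graphs in L^2 x L^2.  This is
   the closure of the graph of T restricted to the domain D. *)
Definition closure_graph (R : realType) (D : set (wavefun R)) (T : operator R) :
    set (wavefun R * wavefun R) :=
  [set fg | [/\ L2 fg.1, L2 fg.2 & exists u : nat -> wavefun R,
     [/\ forall n, D (u n),
         L2norm (fun x => u n x - fg.1 x) @[n --> \oo] --> 0%E &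
         L2norm (fun x => T (u n) x - fg.2 x) @[n --> \oo] --> 0%E]]].

Definition unitary (R : realType) (W : operator R) : Prop :=
  [/\ forall f, L2 f -> L2 (W f),
      forall f g, L2 f -> L2 g -> L2eq f g -> L2eq (W f) (W g),
      forall (a : R[i]) f g, L2 f -> L2 g ->
        L2eq (W (fun x => a * f x + g x)) (fun x => a * W f x + W g x),
      forall f g, L2 f -> L2 g -> inner (W f) (W g) = inner f g &
      forall g, L2 g -> exists2 f, L2 f & L2eq (W f) g].

(* strongly continuous one-parameter unitary groups *)
Definition unitary_group (R : realType) (U : R -> operator R) : Prop :=
  [/\ forall s, unitary (U s),
      forall f, L2 f -> L2eq (U 0 f) f,
      forall r s f, L2 f -> L2eq (U (r + s) f) (U r (U s f)) &
      forall f r, L2 f ->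
        L2norm (fun x => U s f x - U r f x) @[s --> r] --> 0%E].

(* Graph of the self-adjoint H such that i H is the derivative of U at 0,
   i.e. U s = e^{isH}: H f = g iff (U s f - f) / s --> i g in L^2 as s --> 0. *)
Definition generator (R : realType) (U : R -> operator R) :
    set (wavefun R * wavefun R) :=
  [set fg | [/\ L2 fg.1, L2 fg.2 &
     L2norm (fun x => (s^-1)%:C * (U s fg.1 x - fg.1 x) - 'i%C * fg.2 x)
       @[s --> 0^'] --> 0%E]].

(* W = e^{iH}, in the sense of Stone's theorem: W is the time-one value of the
   (unique) strongly continuous unitary group generated by H. *)
Definition is_expi (R : realType) (H : set (wavefun R * wavefun R))
    (W : operator R) : Prop :=
  exists U : R -> operator R,
    [/\ unitary_group U, generator U = H &
        forall f, L2 f -> L2eq (W f) (U 1 f)].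

Definition vacuum (R : realType) : wavefun R :=
  fun x => (pi `^ (- 4^-1) * expR (- (x ^+ 2 / 2)))%:C.

Definition expc (R : realType) (z : R[i]) : R[i] :=
  (expR (complex.Re z) * cos (complex.Im z)) +i* (expR (complex.Re z) * sin (complex.Im z)).

Definition sqrt2q (R : realType) : operator R :=
  scaleop (Num.sqrt 2) (@position R).

Definition sqrt2p (R : realType) : operator R :=
  scaleop (Num.sqrt 2) (@momentum R).

(* A (sqrt 2 q)^2 + B (sqrt 2 q) + C (sqrt 2 p) *)
Definition quadratic_op (R : realType) (A B C : R) : operator R :=
  addop (addop (scaleop A (@sqrt2q R \o @sqrt2q R)) (scaleop B (@sqrt2q R)))
        (scaleop C (@sqrt2p R)).

(* Main.v *)
(* The operator A (sqrt 2 q)^2 + B (sqrt 2 q) + C (sqrt 2 p), multiplied by t, is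
   a q^2 + b q + c p with a = 2 t A, b = sqrt 2 t B, c = sqrt 2 t C.  Transport
   along the line x |-> x + c s gives an explicit candidate for e^{is(a q^2 + b q + c p)}:
     (V_s f)(x) = exp(i int_0^s (a (x + c u)^2 + b (x + c u)) du) f(x + c s).
   V_s preserves C_c^infty, so if U is any unitary group whose generator extends
   the operator on C_c^infty, then for f in C_c^infty the norm || V_s f - U_s f ||
   has derivative 0 in s; hence U_s = V_s on C_c^infty, and on the vacuum by density.
   With y = x + c / 2, <Phi, V_1 Phi> is an explicit constant times J(1), where
     J(s) = int exp(-y^2 + is (a y^2 + b y)) dy.
   Differentiating under the integral and integrating by parts yields a linear
   first-order equation for J, solved by sqrt pi (1 - isa)^{-1/2} exp(- s^2 b^2 / 4 (1 - isa)). *)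
Require Import Defs.
From mathcomp Require Import all_boot all_order all_algebra.
From mathcomp Require Import all_classical all_reals all_analysis.
From mathcomp Require Import measurable_realfun ring lra.

Set Implicit Arguments.
Unset Strict Implicit.
Unset Printing Implicit Defensive.

Import Order.TTheory GRing.Theory Num.Theory.
Import numFieldNormedType.Exports.

Local Open Scope classical_set_scope.
Local Open Scope ring_scope.
Local Open Scope complex_scope.

Local Notation Re := complex.Re.
Local Notation Im := complex.Im.
Local Notation normc := complex.ComplexField.Normc.normc.

(** * Smooth functions *)

Section RealCalculus.
Context {R : realType}.
Implicit Types (f g h : R -> R) (x a b : R).

(** Essential self-adjointness is not re-proved: [is_expi] supplies a unitary group whose generator
    is the closed operator, and that group is compared with the explicit flow vector by vector. The
    flow itself is never shown to be unitary on L^2. Two pointwise facts replace this: the flow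
    composes additively in time, and its phase factor has modulus one, so it changes absolute values
    only by a translation. On C_c^infty every estimate is then a uniform bound on a fixed bounded
    interval. The vacuum has no compact support, so smooth cutoffs have to be built. The linear
    equation for J determines its solution without ambiguity, but matching it with a square root
    leaves a sign. No complex root is differentiated: a squared identity is shown to be constant in
    s, and a connectedness argument in the right half-plane fixes the sign. *)

Lemma derive_add f g x a b : is_derive x 1 f a -> is_derive x 1 g b ->
  is_derive x 1 (fun y => f y + g y) (a + b).
Proof. exact: is_deriveD. Qed.

Lemma derive_sub f g x a b : is_derive x 1 f a -> is_derive x 1 g b ->
  is_derive x 1 (fun y => f y - g y) (a - b).
Proof. exact: is_deriveB. Qed.

Lemma derive_opp f x a : is_derive x 1 f a -> is_derive x 1 (fun y => - f y) (- a).
Proof. exact: is_deriveN. Qed.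

Lemma derive_mul f g x a b : is_derive x 1 f a -> is_derive x 1 g b ->
  is_derive x 1 (fun y => f y * g y) (a * g x + f x * b).
Proof.
move=> df dg; apply: is_derive_eq (is_deriveM df dg) _.
by rewrite /GRing.scale /= addrC [g x * _]mulrC.
Qed.

Lemma derive_chain f g x a b : is_derive (g x) 1 f a -> is_derive x 1 g b ->
  is_derive x 1 (fun y => f (g y)) (a * b).
Proof. exact: is_derive1_comp. Qed.

Lemma derive_const (c : R) x : is_derive x 1 (fun=> c) 0.
Proof. exact: is_derive_cst. Qed.

Lemma derive_var x : is_derive x 1 (fun y : R => y) 1.
Proof. exact: is_derive_id. Qed.

Lemma derive_pow n f x a : is_derive x 1 f a ->
  is_derive x 1 (fun y => f y ^+ n) (n%:R * f x ^+ n.-1 * a).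
Proof.
move=> df; have := is_deriveX n df.
by rewrite /GRing.scale /= (_ : f ^+ n = (fun y => f y ^+ n)) // exprfctE.
Qed.

Lemma derive1_is f x a : is_derive x 1 f a -> derive1 f x = a.
Proof. by move=> [_ <-]; rewrite derive1E. Qed.

Lemma is_derive_derive1 f x : derivable f x 1 -> is_derive x 1 f (derive1 f x).
Proof. by move=> df; rewrite derive1E; exact: derivableP. Qed.

(** [derive1n] adds each new derivative on the outside. Here the first derivative is taken off on
    the inside, so that induction on [n], with [f] general, meets the product and chain rules
    directly. *)
Fixpoint ndiff n f : Prop :=
  if n is n'.+1 then (forall x, derivable f x 1) /\ ndiff n' (derive1 f) else True.

Lemma smoothP f : smooth f <-> forall n, ndiff n f.
Proof.
have shift m g : derive1n m (derive1 g) = derive1n m.+1 g.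
  by elim: m => [|m IH]; rewrite ?derive1n0 ?derive1n1 // derive1nS IH derive1nS.
split=> [sf n|].
  elim: n f sf => //= n IH f sf; split; first exact: (sf 0%N).
  by apply: IH => m x; rewrite shift; exact: sf.
move=> df n; elim: n f df => [|n IH] f df x; first by have [+ _] := df 1%N; exact.
by rewrite -shift; apply: IH => k; have [] := df k.+1.
Qed.

Lemma ndiffS n f : ndiff n.+1 f -> ndiff n f.
Proof. by elim: n f => // n IH f [df /IH]. Qed.

Lemma ndiff_step n f (f' : R -> R) :
  (forall x, is_derive x 1 f (f' x)) -> ndiff n f' -> ndiff n.+1 f.
Proof.
move=> df nf'; split=> [x|]; first by have [] := df x.
by rewrite (_ : derive1 f = f') //; apply/funext => x; exact: derive1_is.
Qed.

Lemma ndiff_is n f x : ndiff n.+1 f -> is_derive x 1 f (derive1 f x).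
Proof. by move=> [df _]; exact: is_derive_derive1. Qed.

Lemma ndiff_cst n (c : R) : ndiff n (fun=> c).
Proof.
by elim: n c => // n IH c; apply: ndiff_step (IH 0) => x; exact: derive_const.
Qed.

Lemma ndiff_id n : ndiff n (fun x : R => x).
Proof.
case: n => // n; apply: (ndiff_step _ (ndiff_cst n 1)) => x; exact: derive_var.
Qed.

Lemma ndiffD n f g : ndiff n f -> ndiff n g -> ndiff n (fun x => f x + g x).
Proof.
elim: n f g => // n IH f g df dg.
apply: (@ndiff_step _ _ (fun x => derive1 f x + derive1 g x)) => [x|].
  apply: derive_add; eauto using ndiff_is.
by case: df dg => _ df [_ dg]; exact: IH.
Qed.

Lemma ndiffM n f g : ndiff n f -> ndiff n g -> ndiff n (fun x => f x * g x).
Proof.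
elim: n f g => // n IH f g df dg.
apply: (@ndiff_step _ _ (fun x => derive1 f x * g x + f x * derive1 g x)) => [x|].
  apply: derive_mul; eauto using ndiff_is.
have [[_ df'] [_ dg']] := (df, dg).
by apply: ndiffD; apply: IH => //; exact: ndiffS.
Qed.

Lemma ndiff_comp n f g : ndiff n f -> ndiff n g -> ndiff n (fun x => f (g x)).
Proof.
elim: n f g => // n IH f g df dg.
apply: (@ndiff_step _ _ (fun x => derive1 f (g x) * derive1 g x)) => [x|].
  apply: derive_chain; eauto using ndiff_is.
have [[_ df'] [_ dg']] := (df, dg).
by apply: ndiffM => //; apply: IH => //; exact: ndiffS.
Qed.

Lemma smooth_cst (c : R) : smooth (fun=> c).
Proof. by apply/smoothP => n; exact: ndiff_cst. Qed.

Lemma smooth_id : smooth (fun x : R => x).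
Proof. by apply/smoothP => n; exact: ndiff_id. Qed.

Lemma smoothD f g : smooth f -> smooth g -> smooth (fun x => f x + g x).
Proof. by move=> /smoothP sf /smoothP sg; apply/smoothP => n; exact: ndiffD. Qed.

Lemma smoothM f g : smooth f -> smooth g -> smooth (fun x => f x * g x).
Proof. by move=> /smoothP sf /smoothP sg; apply/smoothP => n; exact: ndiffM. Qed.

Lemma smooth_comp f g : smooth f -> smooth g -> smooth (fun x => f (g x)).
Proof. by move=> /smoothP sf /smoothP sg; apply/smoothP => n; exact: ndiff_comp. Qed.

Lemma smoothN f : smooth f -> smooth (fun x => - f x).
Proof.
move=> sf; rewrite (_ : (fun _ => _) = fun x => -1 * f x); last first.
  by apply/funext => x; rewrite mulN1r.
by apply: smoothM => //; exact: smooth_cst.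
Qed.

Lemma smoothB f g : smooth f -> smooth g -> smooth (fun x => f x - g x).
Proof. by move=> sf sg; apply: smoothD => //; exact: smoothN. Qed.

Lemma smoothX n f : smooth f -> smooth (fun x => f x ^+ n).
Proof.
move=> sf; elim: n => [|n IH]; first exact: smooth_cst.
under eq_fun do rewrite exprS.
exact: smoothM.
Qed.

Lemma smooth_derive1 f : smooth f -> smooth (derive1 f).
Proof. by move=> /smoothP sf; apply/smoothP => n; have [] := sf n.+1. Qed.

Lemma smooth_is f : smooth f -> forall x, is_derive x 1 f (derive1 f x).
Proof. by move=> sf x; apply: is_derive_derive1; exact: (sf 0%N). Qed.

Lemma is_derive_continuous f : (forall x, derivable f x 1) -> continuous f.
Proof. by move=> df x; apply/differentiable_continuous/derivable1_diffP. Qed.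

Lemma smooth_continuous f : smooth f -> continuous f.
Proof. by move=> sf; apply: is_derive_continuous; exact: (sf 0%N). Qed.

Lemma smooth_expR : smooth (@expR R).
Proof.
apply/smoothP; elim=> // n IH; apply: ndiff_step IH => x; exact: is_derive_expR.
Qed.

Lemma smooth_cos_sin : smooth (@cos R) /\ smooth (@sin R).
Proof.
suff cs n : ndiff n (@cos R) /\ ndiff n (@sin R).
  by split; apply/smoothP => n; have [] := cs n.
elim: n => // n [nc ns]; split; last first.
  by apply: ndiff_step nc => x; exact: is_derive_sin.
apply: (@ndiff_step _ _ (fun x => -1 * sin x)) => [x|].
  by rewrite mulN1r; exact: is_derive_cos.
by apply: ndiffM => //; exact: ndiff_cst.
Qed.

Lemma smooth_cos : smooth (@cos R). Proof. by case: smooth_cos_sin. Qed.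
Lemma smooth_sin : smooth (@sin R). Proof. by case: smooth_cos_sin. Qed.

End RealCalculus.

(** * A smooth function vanishing on the negative half-line *)

Section Bump.
Context {R : realType}.
Implicit Types (f g h : R -> R) (x a b : R).

(** Serves where no differentiation rule applies: the bump function at 0, and the norm of the
    difference of two evolutions. *)
Lemma is_derive_of_cvg f x l :
  h^-1 * (f (h + x) - f x) @[h --> 0^'] --> l -> is_derive x 1 f l.
Proof.
move=> fl; have fl' : h^-1 *: ((f \o shift x) (h *: 1) - f x) @[h --> 0^'] --> l.
  apply: cvg_trans fl; apply: near_eq_cvg; near=> h.
  by rewrite /= /GRing.scale /= mulr1.
by split; [apply/cvg_ex; exists l | exact/cvg_lim].
Unshelve. all: by end_near. Qed.

(* The derivative of [bump_pow k] is a combination of [bump_pow (k + 1)] and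
   [bump_pow (k + 2)], whence smoothness by induction over all [k] at once. *)
Definition bump_pow k x : R := if 0 < x then x^-1 ^+ k * expR (- x^-1) else 0.

(** With y = 1/x one has y^k = x^2 y^(k+2), and y^(k+2) <= (k+2)! e^y is one term of the exponential
    series. The square on the right makes the difference quotient at 0 tend to 0. *)
Lemma bump_pow_le k x : `|bump_pow k x| <= (k.+2)`!%:R * x ^+ 2.
Proof.
rewrite /bump_pow; case: ifPn => [x0|_]; last by rewrite normr0 mulr_ge0 ?sqr_ge0.
have y0 : 0 < x^-1 by rewrite invr_gt0.
rewrite ger0_norm ?mulr_ge0 ?exprn_ge0 ?expR_ge0 ?(ltW y0)//.
have := expR_ge1Dxn k.+1 (ltW y0).
rewrite expRN ler_pdivrMr ?expR_gt0// => H.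
have {}H : x^-1 ^+ k.+2 / (k.+2)`!%:R <= expR x^-1.
  by apply: le_trans H; rewrite lerDr.
have f0 : (0 : R) < (k.+2)`!%:R by rewrite ltr0n fact_gt0.
rewrite ler_pdivrMr// in H.
have -> : x^-1 ^+ k = x ^+ 2 * x^-1 ^+ k.+2.
  have -> : k.+2 = (2 + k)%N by [].
  by rewrite exprD mulrA -exprMn mulfV ?expr1n ?mul1r//; exact: lt0r_neq0.
rewrite [leRHS](_ : _ = x ^+ 2 * (expR x^-1 * (k.+2)`!%:R)); last by ring.
by rewrite ler_pM2l// exprn_gt0.
Qed.

Lemma bump_pow_derive k x :
  is_derive x 1 (bump_pow k) (bump_pow k.+2 x - k%:R * bump_pow k.+1 x).
Proof.
have [x0|x0|->] := ltgtP x 0.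
- rewrite /bump_pow ltNge ltW//= mulr0 subrr.
  apply: near_eq_is_derive (derive_const 0 x).
  near=> y; rewrite ltNge ltW//=; near: y; exact: lt_nbhsl.
- have xn : x != 0 by exact: lt0r_neq0.
  rewrite {2 3}/bump_pow x0.
  apply: (@near_eq_is_derive _ _ _ (fun y : R => y^-1 ^+ k * expR (- y^-1))).
    near=> y; rewrite /bump_pow ifT//; near: y; exact: lt_nbhsr.
  have dV : is_derive x 1 (fun y : R => y^-1) (- x ^- 2).
    by apply: is_derive_eq (is_deriveV xn (derive_var x)) _; rewrite /GRing.scale /= mulr1.
  apply: is_derive_eq (derive_mul (derive_pow k dV)
    (derive_chain (is_derive_expR _) (derive_opp dV))) _.
  case: k => [|k]; first by rewrite /= -exprVn; ring.
  by rewrite /= -exprVn !exprS; ring.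
- rewrite {2 3}/bump_pow ltxx mulr0 subrr.
  apply: is_derive_of_cvg; apply: (@cvg_to_0_linear _ _ (k.+2)`!%:R 1) => // r /andP[r0 _].
  rewrite addr0 {2}/bump_pow ltxx subr0 normrM normfV.
  rewrite mulrC ler_pdivrMr// -mulrA -expr2 -normrX (ger0_norm (sqr_ge0 r)).
  exact: bump_pow_le.
Unshelve. all: by end_near. Qed.

Lemma smooth_bump_pow k : smooth (bump_pow k).
Proof.
apply/smoothP => n; elim: n k => // n IH k.
apply: ndiff_step (fun x => bump_pow_derive k x) _.
apply: ndiffD; first exact: IH.
rewrite (_ : (fun _ => _) = (fun x => - k%:R * bump_pow k.+1 x)); last first.
  by apply/funext => x; rewrite mulNr.
by apply: ndiffM; [exact: ndiff_cst|exact: IH].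
Qed.

End Bump.

(** * Functions from R to R[i] *)

Section ComplexCalculus.
Context {R : realType}.
Implicit Types (f g : R -> R[i]) (x : R).

Lemma Re_add (z w : R[i]) : Re (z + w) = Re z + Re w. Proof. by case: z w => a b [c d]. Qed.
Lemma Im_add (z w : R[i]) : Im (z + w) = Im z + Im w. Proof. by case: z w => a b [c d]. Qed.
Lemma Re_sub (z w : R[i]) : Re (z - w) = Re z - Re w. Proof. by case: z w => a b [c d]. Qed.
Lemma Im_sub (z w : R[i]) : Im (z - w) = Im z - Im w. Proof. by case: z w => a b [c d]. Qed.
Lemma Re_mul (z w : R[i]) : Re (z * w) = Re z * Re w - Im z * Im w.
Proof. by case: z w => a b [c d]. Qed.
Lemma Im_mul (z w : R[i]) : Im (z * w) = Re z * Im w + Im z * Re w.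
Proof. by case: z w => a b [c d]. Qed.
Lemma Re_scale (r : R) (z : R[i]) : Re (r%:C * z) = r * Re z.
Proof. by rewrite Re_mul /= mul0r subr0. Qed.
Lemma Im_scale (r : R) (z : R[i]) : Im (r%:C * z) = r * Im z.
Proof. by rewrite Im_mul /= mul0r addr0. Qed.
Lemma complex_ext (z w : R[i]) : Re z = Re w -> Im z = Im w -> z = w.
Proof. by case: z; case: w => a b c d /= -> ->. Qed.

Lemma normcE2 (z : R[i]) : normc z = Num.sqrt (Re z ^+ 2 + Im z ^+ 2).
Proof. by case: z. Qed.
Lemma normc_ge0 (z : R[i]) : 0 <= normc z.
Proof. by rewrite normcE2 sqrtr_ge0. Qed.
Lemma sqr_normcE (z : R[i]) : normc z ^+ 2 = Re z ^+ 2 + Im z ^+ 2.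
Proof. by rewrite normcE2 sqr_sqrtr ?addr_ge0 ?sqr_ge0. Qed.
Lemma normc_Re (z : R[i]) : `|Re z| <= normc z.
Proof. by rewrite normcE2 -sqrtr_sqr ler_wsqrtr// lerDl sqr_ge0. Qed.
Lemma normc_Im (z : R[i]) : `|Im z| <= normc z.
Proof. by rewrite normcE2 -sqrtr_sqr ler_wsqrtr// lerDr sqr_ge0. Qed.
Lemma normc_le (z : R[i]) : normc z <= `|Re z| + `|Im z|.
Proof.
rewrite normcE2 -[leRHS]ger0_norm ?addr_ge0// -sqrtr_sqr ler_wsqrtr//.
rewrite sqrrD !real_normK ?num_real// [leRHS]addrAC lerDl.
by rewrite mulrn_wge0// mulr_ge0.
Qed.
Lemma normc_real (r : R) : normc r%:C = `|r|.
Proof. by rewrite normcE2 /= expr0n /= addr0 sqrtr_sqr. Qed.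

(** Componentwise, to match [momentum], which differentiates the real and imaginary parts
    separately. *)
Definition is_cderive f x (l : R[i]) :=
  is_derive x 1 (fun y => Re (f y)) (Re l) /\ is_derive x 1 (fun y => Im (f y)) (Im l).

Lemma is_cderive_eq f x (l l' : R[i]) : is_cderive f x l -> l = l' -> is_cderive f x l'.
Proof. by move=> + <-. Qed.

Lemma cderive_cst (c : R[i]) x : is_cderive (fun=> c) x 0.
Proof. by split; exact: derive_const. Qed.

Lemma cderive_real (f : R -> R) x (a : R) : is_derive x 1 f a ->
  is_cderive (fun y => (f y)%:C) x a%:C.
Proof. by split=> //; exact: derive_const. Qed.

Lemma cderiveD f g x a b : is_cderive f x a -> is_cderive g x b ->
  is_cderive (fun y => f y + g y) x (a + b).
Proof.
move=> [fr fi] [gr gi]; split.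
  by under eq_fun do rewrite Re_add; rewrite Re_add; exact: derive_add.
by under eq_fun do rewrite Im_add; rewrite Im_add; exact: derive_add.
Qed.

Lemma cderiveM f g x a b : is_cderive f x a -> is_cderive g x b ->
  is_cderive (fun y => f y * g y) x (a * g x + f x * b).
Proof.
move=> [fr fi] [gr gi]; split.
  under eq_fun do rewrite Re_mul.
  apply: is_derive_eq (derive_sub (derive_mul fr gr) (derive_mul fi gi)) _.
  by rewrite Re_add !Re_mul; ring.
under eq_fun do rewrite Im_mul.
apply: is_derive_eq (derive_add (derive_mul fr gi) (derive_mul fi gr)) _.
by rewrite Im_add !Im_mul; ring.
Qed.

Lemma cderive_comp f (u : R -> R) x (a : R[i]) (b : R) :
  is_cderive f (u x) a -> is_derive x 1 u b ->
  is_cderive (fun y => f (u y)) x (a * b%:C).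
Proof.
move=> [fr fi] du; split.
  rewrite mulrC Re_scale mulrC; exact: (derive_chain fr du).
rewrite mulrC Im_scale mulrC; exact: (derive_chain fi du).
Qed.

Lemma expcD (z w : R[i]) : expc (z + w) = expc z * expc w.
Proof.
apply: complex_ext.
  by rewrite Re_mul /= Re_add Im_add expRD cosD; ring.
by rewrite Im_mul /= Re_add Im_add expRD sinD; ring.
Qed.

Lemma expc0 : expc 0 = 1 :> R[i].
Proof. by apply: complex_ext; rewrite /= expR0 ?cos0 ?sin0 mul1r. Qed.

Lemma normc_expc (z : R[i]) : normc (expc z) = expR (Re z).
Proof.
rewrite normcE2 /= !exprMn -mulrDr cos2Dsin2 mulr1 sqrtr_sqr.
by rewrite ger0_norm ?expR_ge0.
Qed.

Lemma expc_real (r : R) : expc r%:C = (expR r)%:C.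
Proof. by apply: complex_ext; rewrite /= ?cos0 ?sin0 ?mulr1 ?mulr0. Qed.

Lemma cderive_expc f x a : is_cderive f x a ->
  is_cderive (fun y => expc (f y)) x (a * expc (f x)).
Proof.
move=> [fr fi].
have er := derive_chain (is_derive_expR (Re (f x))) fr.
split.
  apply: is_derive_eq (derive_mul er (derive_chain (is_derive_cos (Im (f x))) fi)) _.
  by rewrite Re_mul /=; ring.
apply: is_derive_eq (derive_mul er (derive_chain (is_derive_sin (Im (f x))) fi)) _.
by rewrite Im_mul /=; ring.
Qed.

Definition csmooth f := smooth (fun x => Re (f x)) /\ smooth (fun x => Im (f x)).

Lemma csmoothD f g : csmooth f -> csmooth g -> csmooth (fun x => f x + g x).
Proof.
move=> [fr fi] [gr gi]; split.
  by under eq_fun do rewrite Re_add; exact: smoothD.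
by under eq_fun do rewrite Im_add; exact: smoothD.
Qed.

Lemma csmoothM f g : csmooth f -> csmooth g -> csmooth (fun x => f x * g x).
Proof.
move=> [fr fi] [gr gi]; split.
  by under eq_fun do rewrite Re_mul; apply: smoothB; exact: smoothM.
by under eq_fun do rewrite Im_mul; apply: smoothD; exact: smoothM.
Qed.

Lemma csmooth_cst (c : R[i]) : csmooth (fun=> c).
Proof. by split; exact: smooth_cst. Qed.

Lemma csmooth_real (f : R -> R) : smooth f -> csmooth (fun x => (f x)%:C).
Proof. by split=> //; exact: smooth_cst. Qed.

Lemma csmooth_comp f (u : R -> R) : csmooth f -> smooth u -> csmooth (fun x => f (u x)).
Proof. by move=> [fr fi] su; split; [exact: smooth_comp fr su|exact: smooth_comp fi su]. Qed.

Definition cderiv f x : R[i] :=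
  derive1 (fun y => Re (f y)) x +i* derive1 (fun y => Im (f y)) x.

Lemma csmooth_cderiv f : csmooth f -> csmooth (cderiv f).
Proof. by move=> [fr fi]; split; exact: smooth_derive1. Qed.

Lemma csmooth_is f x : csmooth f -> is_cderive f x (cderiv f x).
Proof. by move=> [fr fi]; split; exact: smooth_is. Qed.

(* Mean value theorem applied twice, to [r] and to [r']. *)
Lemma difference_quotient_le (r r' r'' : R -> R) (M h : R) :
  (forall s : R, is_derive s 1 r (r' s)) -> (forall s : R, is_derive s 1 r' (r'' s)) ->
  (forall s, `|r'' s| <= M) -> h != 0 ->
  `|h^-1 * (r h - r 0) - r' 0| <= M * `|h|.
Proof.
have mvt (u u' : R -> R) (y : R) : (forall s : R, is_derive s 1 u (u' s)) ->
    exists2 c, `|c| <= `|y| & u y - u 0 = u' c * y.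
  move=> du; have cu A : {within A, continuous u}.
    by apply: continuous_subspaceT; apply: is_derive_continuous => s; have [] := du s.
  have [y0|y0] := leP 0 y.
    have [c + ->] := MVT_segment y0 (fun s _ => du s) (cu _).
    rewrite in_itv /= => /andP[c0 cy]; exists c; last by rewrite subr0.
    by rewrite !ger0_norm.
  have [c + E] := MVT_segment (ltW y0) (fun s _ => du s) (cu _).
  rewrite in_itv /= => /andP[c0 cy]; exists c.
    by rewrite !ler0_norm ?lerN2// ltW.
  by rewrite -opprB E sub0r mulrN opprK.
move=> dr dr' bM h0.
have [c ch ->] := mvt _ _ h dr.
have [e _ E] := mvt _ _ c dr'.
rewrite mulrC mulfK// E normrM ler_pM//.
Qed.

End ComplexCalculus.

(** * The explicit flow *)

Section CompactSupport.
Context {R : realType}.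
Implicit Types (f g : R -> R[i]).

(** The working form of compact support. The radius [K] carries no sign condition, so later bounds
    pass to its absolute value or treat [K < 0] apart. *)
Lemma Cc_inftyP f :
  Cc_infty f <-> csmooth f /\ exists K, forall x, K < `|x| -> f x = 0.
Proof.
split=> [[fr fi cf]|[[fr fi] [K fK]]].
  split=> //; have [K [_ bK]] := compact_bounded cf.
  exists (K + 1) => x xK; apply/eqP/negP => /negP fx0.
  have /(_ x) : globally (closure [set x | f x != 0]) [set x | `|x| <= K + 1].
    by apply: bK; rewrite ltrDl.
  by rewrite /= leNgt xK => H; apply/negP: isT; apply: H; exact: subset_closure.
split=> //.
have sub : [set x | f x != 0] `<=` `[-K, K].
  move=> x /= fx0; rewrite in_itv /= -ler_norml leNgt; apply/negP => /fK.
  by move/eqP; rewrite (negbTE fx0).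
apply: (@subclosed_compact _ _ `[-K, K]); first exact: closed_closure.
  exact: segment_compact.
have /closure_id -> : closed `[-K, K] by exact: itv_closed.
exact: closure_subset.
Qed.

Lemma bounded_of_support (g : R -> R) K : continuous g ->
  (forall x, K < `|x| -> g x = 0) -> exists2 M, 0 <= M & forall x, `|g x| <= M.
Proof.
move=> cg gK; have [K0|K0] := ltP K 0.
  by exists 0 => // x; rewrite gK ?normr0// (lt_le_trans K0).
have KK : - K <= K by rewrite (le_trans _ K0)// oppr_le0.
have [] := @EVT_max R (fun x => `|g x|) (- K) K KK.
  apply: continuous_subspaceT => x; apply: cvg_norm; exact: cg.
move=> u _ gu; exists `|g u| => // x.
have [xK|xK] := leP `|x| K; first by apply: gu; rewrite in_itv /= -ler_norml.
by rewrite gK// normr0.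
Qed.

Lemma Cc_infty_bounded f : Cc_infty f -> exists2 M, 0 <= M & forall x, normc (f x) <= M.
Proof.
move=> /Cc_inftyP[[fr fi] [K fK]].
have [|M M0 bM] := @bounded_of_support (fun x => Re (f x)) K (smooth_continuous fr).
  by move=> x /fK ->.
have [|N N0 bN] := @bounded_of_support (fun x => Im (f x)) K (smooth_continuous fi).
  by move=> x /fK ->.
exists (M + N) => [|x]; first exact: addr_ge0.
by apply: le_trans (normc_le _) _; exact: lerD.
Qed.

Lemma Cc_infty_mul g f : csmooth g -> Cc_infty f -> Cc_infty (fun x => g x * f x).
Proof.
move=> sg /Cc_inftyP[sf [K fK]]; apply/Cc_inftyP; split; first exact: csmoothM.
by exists K => x /fK ->; rewrite mulr0.
Qed.

Lemma Cc_infty_add f g : Cc_infty f -> Cc_infty g -> Cc_infty (fun x => f x + g x).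
Proof.
move=> /Cc_inftyP[sf [K fK]] /Cc_inftyP[sg [L gL]]; apply/Cc_inftyP.
split; first exact: csmoothD.
exists (Num.max K L) => x; rewrite gt_max => /andP[/fK -> /gL ->].
by rewrite addr0.
Qed.

(** The condition [K < |x|] is open, so beyond the radius [f] vanishes on a whole neighbourhood and
    its derivative does too. *)
Lemma Cc_infty_cderiv f : Cc_infty f -> Cc_infty (cderiv f).
Proof.
move=> /Cc_inftyP[sf [K fK]]; apply/Cc_inftyP; split; first exact: csmooth_cderiv.
exists K => x Kx.
have near0 : \forall y \near x, f y = 0.
  have : \forall y \near x, K < `|y|.
    have /cvgrPdist_lt/(_ (`|x| - K)) : `|y| @[y --> x] --> `|x| by apply: cvg_norm.
    rewrite subr_gt0 => /(_ Kx); apply: filterS => y /ltr_normlW.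
    by rewrite ltrD2l ltrN2.
  by apply: filterS => y /fK.
have d0 (u : R[i] -> R) : u 0 = 0 -> derive1 (fun y => u (f y)) x = 0.
  move=> u0; apply: derive1_is; apply: near_eq_is_derive (derive_const 0 x).
  by near=> y; rewrite (near near0 y)// u0.
by rewrite /cderiv !d0.
Unshelve. all: by end_near. Qed.

Lemma Cc_infty_shift f (d : R) : Cc_infty f -> Cc_infty (fun x => f (x + d)).
Proof.
move=> /Cc_inftyP[sf [K fK]]; apply/Cc_inftyP; split.
  by apply: csmooth_comp => //; apply: smoothD; [exact: smooth_id|exact: smooth_cst].
exists (K + `|d|) => x Kx; apply: fK.
rewrite -(ltrD2r `|d|); apply: lt_le_trans Kx _.
by rewrite -[X in `|X| <= _](addrK d) -(normrN d) ler_normD.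
Qed.

End CompactSupport.

Section Flow.
Context {R : realType} (a b c : R).
Implicit Types (f g : R -> R[i]).

Definition hamiltonian f x : R[i] :=
  (a * x ^+ 2 + b * x)%:C * f x + c%:C * momentum f x.

(** The integral of a (x + c u)^2 + b (x + c u) over u from 0 to s, evaluated. *)
Definition phase (s x : R) : R :=
  a * (s * x ^+ 2 + c * s ^+ 2 * x + c ^+ 2 * s ^+ 3 / 3) + b * (s * x + c * s ^+ 2 / 2).

Definition flow (s : R) f x : R[i] := expc ('i%C * (phase s x)%:C) * f (x + c * s).

Lemma flow0 f : flow 0 f = f.
Proof.
apply/funext => x; rewrite /flow /phase (_ : a * _ + _ = 0); last by field.
by rewrite mulr0 expc0 mul1r mulr0 addr0.
Qed.

(** The phase is a cocycle over the translation: [phase (s + h) x] is [phase h x] plus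
    [phase s (x + c * h)], the integral split at time h. *)
Lemma flowD s h f : flow (s + h) f = flow h (flow s f).
Proof.
apply/funext => x; rewrite /flow mulrA -expcD -mulrDr -rmorphD.
rewrite (_ : x + c * h + c * s = x + c * (s + h)); last by ring.
congr (expc ('i%C * _%:C) * _).
by rewrite /phase; field.
Qed.

Lemma normc_flow s f x : normc (flow s f x) = normc (f (x + c * s)).
Proof.
rewrite /flow complex.ComplexField.Normc.normcM normc_expc.
by rewrite Re_mul /= mul0r mulr0 subr0 expR0 mul1r.
Qed.

Lemma flowB s f g x : flow s f x - flow s g x = flow s (fun y => f y - g y) x.
Proof. by rewrite /flow mulrBr. Qed.

Lemma hamiltonian_Cc f : Cc_infty f -> Cc_infty (hamiltonian f).
Proof.
move=> Cf; apply: Cc_infty_add.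
  apply: Cc_infty_mul Cf; apply: csmooth_real; apply: smoothD; apply: smoothM.
  - exact: smooth_cst.
  - by apply: smoothX; exact: smooth_id.
  - exact: smooth_cst.
  - exact: smooth_id.
apply: Cc_infty_mul; first exact: csmooth_cst.
by apply: Cc_infty_mul; [exact: csmooth_cst|exact: Cc_infty_cderiv].
Qed.

Lemma smooth_phase s : smooth (phase s).
Proof.
rewrite (_ : phase s = fun x => a * s * x ^+ 2 + ((a * c * s ^+ 2 + b * s) * x +
    (a * c ^+ 2 * s ^+ 3 / 3 + b * c * s ^+ 2 / 2))); last first.
  by apply/funext => x; rewrite /phase; field.
by apply: smoothD; [|apply: smoothD; [|exact: smooth_cst]]; apply: smoothM;
  [exact: smooth_cst|apply: smoothX; exact: smooth_id|exact: smooth_cst|exact: smooth_id].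
Qed.

Lemma csmooth_expc_i (u : R -> R) : smooth u -> csmooth (fun x => expc ('i%C * (u x)%:C)).
Proof.
move=> su; have E x : 'i%C * (u x)%:C = 0 +i* u x.
  by apply: complex_ext; rewrite ?Re_mul ?Im_mul /=; ring.
split; under eq_fun do rewrite E /= expR0 mul1r.
  exact: smooth_comp smooth_cos su.
exact: smooth_comp smooth_sin su.
Qed.

Lemma flow_Cc s f : Cc_infty f -> Cc_infty (flow s f).
Proof.
move=> Cf; apply: Cc_infty_mul; last exact: Cc_infty_shift.
exact/csmooth_expc_i/smooth_phase.
Qed.

Lemma phase_derive (s x : R) :
  is_derive s 1 (fun r => phase r x) (a * (x + c * s) ^+ 2 + b * (x + c * s)).
Proof.
have d1 := derive_var s.
have c1 k := derive_const k s.
apply: is_derive_eq (derive_add (derive_mul (c1 a)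
  (derive_add (derive_add (derive_mul d1 (c1 (x ^+ 2)))
     (derive_mul (derive_mul (c1 c) (derive_pow 2 d1)) (c1 x)))
     (derive_mul (derive_mul (c1 (c ^+ 2)) (derive_pow 3 d1)) (c1 3^-1))))
  (derive_mul (c1 b) (derive_add (derive_mul d1 (c1 x))
     (derive_mul (derive_mul (c1 c) (derive_pow 2 d1)) (c1 2^-1))))) _.
by rewrite /=; field.
Qed.

(** The derivatives of the phase and of the translation both bring out coefficients at the point x +
    c s, so the derivative is the flow applied to i times the Hamiltonian. This form can be
    differentiated again by the same lemma. *)
Lemma flow_derive f (s x : R) : csmooth f ->
  is_cderive (fun r => flow r f x) s (flow s (fun y => 'i%C * hamiltonian f y) x).
Proof.
move=> sf.
have dshift : is_derive s 1 (fun r => x + c * r) c.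
  apply: is_derive_eq (derive_add (derive_const x s)
    (derive_mul (derive_const c s) (derive_var s))) _.
  by rewrite mul0r !add0r mulr1.
apply: is_cderive_eq (cderiveM (cderive_expc
  (cderiveM (cderive_cst 'i%C s) (cderive_real (phase_derive s x))))
  (cderive_comp (csmooth_is _ sf) dshift)) _.
rewrite /flow /hamiltonian /momentum -/(cderiv f _).
have i0 : ('i%C : R[i]) != 0 by rewrite eq_complex /= oner_eq0 andbF.
by field.
Qed.

(** At fixed x the second time derivative of the flow is the flow of (iH)^2 f. Its modulus is
    bounded by the supremum of |(iH)^2 f|, uniformly in time and in x, so a second-order estimate
    holds with one constant. *)
Lemma flow_difference_quotient f : Cc_infty f -> exists M K : R, forall h x, h != 0 -> `|h| <= 1 ->
  normc ((h^-1)%:C * (flow h f x - f x) - 'i%C * hamiltonian f x) <= M * `|h| /\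
  (K < `|x| -> (h^-1)%:C * (flow h f x - f x) - 'i%C * hamiltonian f x = 0).
Proof.
move=> Cf; have Ci g : Cc_infty g -> Cc_infty (fun y => 'i%C * hamiltonian g y).
  by move=> /hamiltonian_Cc; apply: Cc_infty_mul; exact: csmooth_cst.
have Cg := Ci _ Cf; set g := (X in Cc_infty X) in Cg.
have Cg2 := Ci _ Cg; set g2 := (X in Cc_infty X) in Cg2.
have [M _ bM] := Cc_infty_bounded Cg2.
have /Cc_inftyP[sf [K fK]] := Cf; have /Cc_inftyP[sg [L gL]] := Cg.
(* The real and imaginary parts contribute [M] each; for |h| <= 1 the translation enlarges the
   support by at most |c|. *)
exists (M + M), (Num.max (K + `|c|) L) => h x h0 h1; split; last first.
  rewrite gt_max => /andP[Kx Lx].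
  rewrite -/(g x) (gL _ Lx) (fK x); last first.
    by apply: le_lt_trans Kx; rewrite lerDl.
  rewrite /flow fK ?mulr0 ?subrr ?mulr0 ?subrr//.
  rewrite -(ltrD2r `|c|); apply: lt_le_trans Kx _.
  rewrite -[X in `|X| <= _](addrK (c * h)) (le_trans (ler_normB _ _))// lerD2l.
  by rewrite normrM ler_piMr.
have df r : is_cderive (fun r => flow r f x) r (flow r g x) by exact: flow_derive.
have dg r : is_cderive (fun r => flow r g x) r (flow r g2 x) by exact: flow_derive.
have b2 r : normc (flow r g2 x) <= M by rewrite normc_flow.
rewrite mulrDl; apply: le_trans (normc_le _) _.
rewrite Re_sub Im_sub Re_scale Im_scale Re_sub Im_sub; apply: lerD.
  have := @difference_quotient_le _ (fun r => Re (flow r f x))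
    (fun r => Re (flow r g x)) (fun r => Re (flow r g2 x)) M h.
  rewrite !flow0; apply => // r; [by case: (df r)|by case: (dg r)|].
  exact: le_trans (normc_Re _) _.
have := @difference_quotient_le _ (fun r => Im (flow r f x))
  (fun r => Im (flow r g x)) (fun r => Im (flow r g2 x)) M h.
rewrite !flow0; apply => // r; [by case: (df r)|by case: (dg r)|].
exact: le_trans (normc_Im _) _.
Qed.

End Flow.

(** * The L^2 norm *)

Section L2norm.
Context {R : realType}.
Local Notation mu := (@lebesgue_measure R).
Implicit Types (f g h : R -> R[i]).

Definition cmeas f := measurable_fun setT (fun x => Re (f x)) /\
  measurable_fun setT (fun x => Im (f x)).

Lemma L2P f : L2 f <-> cmeas f /\ (L2norm f < +oo)%E.
Proof. by split=> [[]|[[]]]. Qed.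

Lemma measurable_normc f : cmeas f -> measurable_fun setT (fun x => normc (f x)).
Proof.
move=> [mr mi]; under eq_fun do rewrite normcE2.
apply: (@measurableT_comp _ _ _ _ _ _ (@Num.sqrt R)).
  apply: continuous_measurable_fun; exact: sqrt_continuous.
by apply: measurable_funD; exact: measurable_funX.
Qed.

Lemma cmeasD f g : cmeas f -> cmeas g -> cmeas (fun x => f x + g x).
Proof.
move=> [fr fi] [gr gi]; split.
  by under eq_fun do rewrite Re_add; exact: measurable_funD.
by under eq_fun do rewrite Im_add; exact: measurable_funD.
Qed.

Lemma cmeasM f g : cmeas f -> cmeas g -> cmeas (fun x => f x * g x).
Proof.
move=> [fr fi] [gr gi]; split.
  by under eq_fun do rewrite Re_mul; apply: measurable_funB; exact: measurable_funM.
by under eq_fun do rewrite Im_mul; apply: measurable_funD; exact: measurable_funM.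
Qed.

Lemma cmeas_cst (z : R[i]) : cmeas (fun=> z).
Proof. by split; exact: measurable_cst. Qed.

Lemma cmeasB f g : cmeas f -> cmeas g -> cmeas (fun x => f x - g x).
Proof.
move=> [fr fi] [gr gi]; split.
  by under eq_fun do rewrite Re_sub; exact: measurable_funB.
by under eq_fun do rewrite Im_sub; exact: measurable_funB.
Qed.

Lemma csmooth_cmeas f : csmooth f -> cmeas f.
Proof.
by move=> [fr fi]; split; apply: continuous_measurable_fun; exact: smooth_continuous.
Qed.

Lemma L2normE f : L2norm f = ((\int[mu]_x (normc (f x) ^+ 2)%:E) `^ 2^-1)%E.
Proof.
rewrite /L2norm unlock; congr (_ `^ _)%E; apply: eq_integral => x _.
by rewrite gee0_abs ?lee_fin ?normc_ge0// poweR_EFin powR_mulrn// normc_ge0.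
Qed.

Lemma L2norm_ge0 f : (0 <= L2norm f)%E.
Proof. exact: Lnorm_ge0. Qed.

Lemma eq_L2norm f g : (forall x, normc (f x) = normc (g x)) -> L2norm f = L2norm g.
Proof. by move=> fg; apply: eq_Lnorm => x; rewrite fg. Qed.

Lemma L2norm_integral_le f (r : R) : 0 <= r ->
  (\int[mu]_x (normc (f x) ^+ 2)%:E <= (r ^+ 2)%:E)%E -> (L2norm f <= r%:E)%E.
Proof.
move=> r0 H; rewrite L2normE.
have -> : r%:E = ((r ^+ 2)%:E `^ 2^-1)%E.
  by rewrite poweR_EFin powR12_sqrt ?sqr_ge0// sqrtr_sqr ger0_norm.
apply: gt0_ler_poweR => //.
- rewrite in_itv /= leey andbT; apply: integral_ge0 => x _; exact: sqr_ge0.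
- by rewrite in_itv /= leey andbT lee_fin sqr_ge0.
Qed.

Lemma L2norm_le f (u : R -> R) : cmeas f -> measurable_fun setT u ->
  (forall x, normc (f x) <= u x) -> (L2norm f <= 'N[mu]_2%:E[EFin \o u])%E.
Proof.
move=> mf mu' fu; rewrite L2normE unlock.
have E x : (`|(EFin \o u) x| `^ 2)%E = (u x ^+ 2)%:E.
  have u0 : 0 <= u x by apply: le_trans (fu x); exact: normc_ge0.
  by rewrite /= ger0_norm// powR_mulrn.
under [X in (_ <= X `^ _)%E]eq_integral do rewrite E.
apply: gt0_ler_poweR => //.
- rewrite in_itv /= leey andbT; apply: integral_ge0 => x _; exact: sqr_ge0.
- rewrite in_itv /= leey andbT; apply: integral_ge0 => x _; exact: sqr_ge0.
apply: ge0_le_integral => //.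
- by move=> x _; exact: sqr_ge0.
- by apply/measurable_EFinP; apply: measurable_funX; exact: measurable_normc.
- by apply/measurable_EFinP; exact: measurable_funX.
- move=> x _; rewrite lee_fin ler_pXn2r// nnegrE ?normc_ge0//.
  exact: le_trans (normc_ge0 _) (fu x).
Qed.

(** Reduces to Minkowski's inequality for the real functions |f| and |g|. *)
Lemma L2normD_le f g : cmeas f -> cmeas g ->
  (L2norm (fun x => f x + g x)%R <= L2norm f + L2norm g)%E.
Proof.
move=> mf mg; have mnf := measurable_normc mf; have mng := measurable_normc mg.
apply: le_trans (minkowski_EFin mu mnf mng _); last by rewrite ler1n.
apply: L2norm_le; [exact: cmeasD| exact: measurable_funD|].
by move=> x; exact: le_normcD.
Qed.

Lemma L2normC f g : L2norm (fun x => f x - g x) = L2norm (fun x => g x - f x).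
Proof. by apply: eq_L2norm => x; rewrite -normcN opprB. Qed.

Lemma L2normB_le f g : cmeas f -> cmeas g ->
  (L2norm (fun x => f x - g x)%R <= L2norm f + L2norm g)%E.
Proof.
move=> mf mg; have mng : cmeas (fun x => - g x).
  rewrite (_ : (fun _ => _) = fun x => 0 - g x); last by apply/funext=> x; rewrite sub0r.
  by apply: cmeasB => //; exact: cmeas_cst.
apply: le_trans (L2normD_le mf mng) _; rewrite leeD2l// le_eqVlt; apply/orP; left.
by apply/eqP/eq_L2norm => x; rewrite normcN.
Qed.

Lemma L2norm_dist_le f g h : cmeas f -> cmeas g -> cmeas h ->
  (L2norm (fun x => f x - g x)%R <=
   L2norm (fun x => f x - h x)%R + L2norm (fun x => h x - g x)%R)%E.
Proof.
move=> mf mg mh; rewrite (_ : (fun x => f x - g x) = fun x => (f x - h x) + (h x - g x)).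
  by apply: L2normD_le; exact: cmeasB.
by apply/funext => x; rewrite addrA subrK.
Qed.

Lemma L2normZ (r : R) f : cmeas f -> L2norm (fun x => r%:C * f x) = (`|r|%:E * L2norm f)%E.
Proof.
move=> mf; rewrite !L2normE.
under eq_integral => x _.
  rewrite complex.ComplexField.Normc.normcM normc_real exprMn EFinM; over.
rewrite ge0_integralZl//=; last 2 first.
- by apply/measurable_EFinP; apply: measurable_funX; exact: measurable_normc.
- by move=> x _; exact: sqr_ge0.
rewrite poweRM ?lee_fin ?sqr_ge0//; last by apply: integral_ge0 => x _; exact: sqr_ge0.
by rewrite poweR_EFin powR12_sqrt ?sqr_ge0// sqrtr_sqr normr_id.
Qed.

Lemma L2norm_ae f g : cmeas f -> cmeas g -> L2eq f g -> L2norm f = L2norm g.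
Proof.
move=> mf mg fg; rewrite !L2normE; congr (_ `^ _)%E.
apply: ge0_ae_eq_integral => //.
- by apply/measurable_EFinP; apply: measurable_funX; exact: measurable_normc.
- by apply/measurable_EFinP; apply: measurable_funX; exact: measurable_normc.
- by move=> x _; exact: sqr_ge0.
- by move=> x _; exact: sqr_ge0.
- by move: fg; rewrite /L2eq; apply: (@filterS _ _ (ae_filter_ringOfSetsType mu)) => x -> _.
Qed.

Lemma L2norm0 : L2norm (fun=> 0 : R[i]) = 0%E.
Proof.
rewrite -[RHS](@Lnorm0 _ _ _ mu 2%:E)//.
by apply: eq_Lnorm => x; rewrite complex.ComplexField.Normc.normc0.
Qed.

Lemma L2norm_subrr f : L2norm (fun x => f x - f x) = 0%E.
Proof. by under eq_fun do rewrite subrr; exact: L2norm0. Qed.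

Lemma L2norm_eq0 f : cmeas f -> L2norm f = 0%E -> L2eq f (fun=> 0).
Proof.
move=> mf /Lnorm_eq0_eq0 H; have := H _ _; rewrite /L2eq => {}H.
have : {ae mu, forall x, setT x -> (normc (f x))%:E = 0%E}.
  apply: H; last by rewrite lte_fin.
  by apply/measurable_EFinP; exact: measurable_normc.
apply: (@filterS _ _ (ae_filter_ringOfSetsType mu)) => x /(_ I) [].
by move/complex.ComplexField.Normc.eq0_normc.
Qed.

Lemma L2B f g : L2 f -> L2 g -> L2 (fun x => f x - g x).
Proof.
move=> /L2P[mf nf] /L2P[mg ng]; apply/L2P; split; first exact: cmeasB.
by apply: le_lt_trans (L2normB_le mf mg) _; exact: lte_add_pinfty.
Qed.

Lemma L2_cmeas f : L2 f -> cmeas f. Proof. by case/L2P. Qed.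

Lemma L2norm_fin f : L2 f -> L2norm f \is a fin_num.
Proof. by case/L2P => _ fo; rewrite ge0_fin_numE// L2norm_ge0. Qed.

Lemma L2norm_support_le f (M K : R) : cmeas f -> 0 <= M -> 0 <= K ->
  (forall x, normc (f x) <= M) -> (forall x, K < `|x| -> f x = 0) ->
  (L2norm f <= (M * Num.sqrt (K *+ 2))%:E)%E.
Proof.
move=> mf M0 K0 fM fK.
apply: L2norm_integral_le; first by rewrite mulr_ge0 ?sqrtr_ge0.
have le1 x : (normc (f x) ^+ 2)%:E = ((fun x => (normc (f x) ^+ 2)%:E) \_ `[-K, K]) x.
  rewrite /patch; case: ifPn => //; rewrite notin_setE /= in_itv /= -ler_norml.
  move/negP; rewrite -ltNge => /fK ->; rewrite complex.ComplexField.Normc.normc0.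
  by rewrite expr0n.
under eq_integral do rewrite le1.
rewrite -integral_mkcond.
apply: (@le_trans _ _ (\int[mu]_(x in `[(- K)%R, K]) (M ^+ 2)%:E)%E).
  apply: ge0_le_integral => //.
  - by move=> x _; exact: sqr_ge0.
  - apply: measurable_funTS; apply/measurable_EFinP; apply: measurable_funX.
    exact: measurable_normc.
  - by move=> x _; rewrite lee_fin ler_pXn2r// nnegrE normc_ge0.
rewrite integral_cst//= lebesgue_measure_itv /= lte_fin.
rewrite exprMn sqr_sqrtr ?mulrn_wge0//.
case: ifPn => _; first by rewrite opprK -mulr2n -EFinM.
by rewrite mule0 lee_fin mulr_ge0 ?sqr_ge0 ?mulrn_wge0.
Qed.

Lemma Cc_infty_L2 f : Cc_infty f -> L2 f.
Proof.
move=> Cf; have [M M0 bM] := Cc_infty_bounded Cf.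
have /Cc_inftyP[sf [K fK]] := Cf.
apply/L2P; split; first exact: csmooth_cmeas.
have : (L2norm f <= (M * Num.sqrt (`|K| *+ 2))%:E)%E.
  apply: L2norm_support_le => //; first exact: csmooth_cmeas.
  by move=> x Kx; apply: fK; apply: le_lt_trans Kx; exact: ler_norm.
by move=> /le_lt_trans; apply; rewrite ltry.
Qed.

Lemma unitary_L2norm (W : operator R) f : unitary W -> L2 f -> L2norm (W f) = L2norm f.
Proof.
move=> [W1 _ _ W4 _] Lf.
have inner_sq g : L2 g -> (\int[mu]_x (normc (g x) ^+ 2)%:E = (Re (inner g g))%:E)%E.
  move=> Lg; rewrite /inner /= /Rintegral.
  have -> : (\int[mu]_x (Re (conjc (g x) * g x))%:E = \int[mu]_x (normc (g x) ^+ 2)%:E)%E.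
    apply: eq_integral => x _; rewrite sqr_normcE; case: (g x) => p q /=.
    by congr (_%:E); ring.
  (* [Rintegral] passes through [fine], which sends infinity to 0, so finiteness of the squared
     integral has to be drawn from [L2 g]. *)
  rewrite fineK// ge0_fin_numE; last by apply: integral_ge0 => x _; exact: sqr_ge0.
  case/L2P: Lg => _; rewrite L2normE => /lty_poweRy; apply.
  by rewrite invr_eq0 pnatr_eq0.
by rewrite !L2normE (inner_sq _ Lf) (inner_sq _ (W1 _ Lf)) W4.
Qed.

End L2norm.

(** * The flow is the unitary group *)

Section Uniqueness.
Context {R : realType}.
Local Notation mu := (@lebesgue_measure R).
Implicit Types (f g h : R -> R[i]).

(** Turns the extended-real limits in [generator] and in the approximation lemmas into epsilon
    bounds; finiteness near the limit comes with the bound. *)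
Lemma cvge0P (T : Type) (F : set_system T) (FF : Filter F) (u : T -> \bar R) :
  (forall x, 0 <= u x)%E ->
  u x @[x --> F] --> 0%E <-> (forall e : R, 0 < e -> \forall x \near F, (u x <= e%:E)%E).
Proof.
move=> u0; split=> [/fine_cvgP[fu /cvgrPdist_le cu] e e0|H].
  apply: filterS2 fu (cu e e0) => x fx.
  by rewrite sub0r normrN /= ger0_norm ?fine_ge0// -lee_fin fineK.
apply/fine_cvgP; split.
  apply: filterS (H 1 ltr01) => x ux; rewrite ge0_fin_numE//.
  by apply: le_lt_trans ux _; rewrite ltry.
apply/cvgrPdist_le => e e0; apply: filterS (H e e0) => x ux.
rewrite sub0r normrN /= ger0_norm ?fine_ge0// -lee_fin fineK// ge0_fin_numE//.
by apply: le_lt_trans ux _; rewrite ltry.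
Qed.

Lemma flow_quotient_cvg (a b c : R) f : Cc_infty f ->
  L2norm (fun x => (h^-1)%:C * (flow a b c h f x - f x) - 'i%C * hamiltonian a b c f x)
    @[h --> 0^'] --> 0%E.
Proof.
move=> Cf; have [M [K H]] := flow_difference_quotient a b c Cf.
apply/cvge0P => [h|e e0]; first exact: L2norm_ge0.
(* The added 1 keeps [B] positive, so that e / B is an admissible threshold. *)
pose B := `|M| * Num.sqrt (`|K| *+ 2) + 1.
have B0 : 0 < B by rewrite ltr_wpDl// mulr_ge0 ?sqrtr_ge0.
near=> h.
have h0 : h != 0 by near: h; exact: nbhs_dnbhs_neq.
have h1 : `|h| <= 1 by near: h; exact: dnbhs0_le.
have hB : `|h| <= e / B by near: h; apply: dnbhs0_le; rewrite divr_gt0.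
apply: (@le_trans _ _ (`|M| * `|h| * Num.sqrt (`|K| *+ 2))%:E).
  apply: L2norm_support_le => //.
  - have cm g : Cc_infty g -> cmeas g by case/Cc_infty_L2.
    apply: cmeasB; apply: cmeasM; try exact: cmeas_cst.
      by apply: cmeasB; apply: cm => //; exact: flow_Cc.
    by apply: cm; exact: hamiltonian_Cc.
  - move=> x; have [+ _] := H h x h0 h1 => /le_trans; apply.
    by rewrite ler_wpM2r// ler_norm.
  - move=> x Kx; have [_ ->] := H h x h0 h1 => //.
    by apply: le_lt_trans Kx; exact: ler_norm.
rewrite lee_fin mulrAC; apply: (@le_trans _ _ (B * `|h|)).
  by rewrite ler_wpM2r// lerDl.
by rewrite mulrC -ler_pdivlMr.
Unshelve. all: by end_near. Qed.

Lemma unitary_sub (W : operator R) f g : unitary W -> L2 f -> L2 g ->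
  L2eq (W (fun x => f x - g x)) (fun x => W f x - W g x).
Proof.
move=> [_ _ W3 _ _] Lf Lg; have := W3 (-1) g f Lg Lf.
rewrite (_ : (fun x => -1 * g x + f x) = (fun x => f x - g x)); last first.
  by apply/funext => x; rewrite mulN1r addrC.
rewrite (_ : (fun x => -1 * W g x + W f x) = (fun x => W f x - W g x)) //.
by apply/funext => x; rewrite mulN1r addrC.
Qed.

Lemma L2eq_trans f g h : L2eq f g -> L2eq g h -> L2eq f h.
Proof.
rewrite /L2eq => fg gh.
exact: (@filterS2 _ _ (ae_filter_ringOfSetsType mu) _ _ _ (fun x e e' => etrans e e') fg gh).
Qed.

Lemma L2eq_sym f g : L2eq f g -> L2eq g f.
Proof.
rewrite /L2eq; apply: (@filterS _ _ (ae_filter_ringOfSetsType mu)) => x; exact: esym.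
Qed.

Lemma L2eq_sub f f' g g' : L2eq f f' -> L2eq g g' ->
  L2eq (fun x => f x - g x) (fun x => f' x - g' x).
Proof.
rewrite /L2eq => ff gg.
by apply: (@filterS2 _ _ (ae_filter_ringOfSetsType mu) _ _ _ _ ff gg) => x -> ->.
Qed.

Lemma L2norm_eq0_L2eq f g : cmeas f -> cmeas g ->
  L2norm (fun x => f x - g x) = 0%E -> L2eq f g.
Proof.
move=> mf mg /(L2norm_eq0 (cmeasB mf mg)); rewrite /L2eq.
apply: (@filterS _ _ (ae_filter_ringOfSetsType mu)) => x /eqP.
by rewrite subr_eq0 => /eqP.
Qed.

(* s |-> || flow s f - U s f || has derivative 0: by unitarity of U_h its increment
   from s to s + h is at most || flow h g - U h g || with g = flow s f, which is o(h). *)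
Lemma unitary_group_flow (a b c : R) (U : R -> operator R) f (s : R) :
  unitary_group U ->
  (forall g, Cc_infty g -> generator U (g, hamiltonian a b c g)) ->
  Cc_infty f -> L2eq (U s f) (flow a b c s f).
Proof.
move=> [uU U0 UD _] gen Cf.
have Lf := Cc_infty_L2 Cf.
have LU r g : L2 g -> L2 (U r g) by case: (uU r) => + _ _ _ _; apply.
have Lflow r g : Cc_infty g -> L2 (flow a b c r g).
  by move=> Cg; apply: Cc_infty_L2; exact: flow_Cc.
pose m r := fine (L2norm (fun x => flow a b c r f x - U r f x)).
have m0 : m 0 = 0.
  rewrite /m flow0 (@L2norm_ae _ _ (fun x => f x - f x)).
  - by rewrite L2norm_subrr.
  - by apply: L2_cmeas; apply: L2B => //; exact: LU.
  - by apply: L2_cmeas; exact: L2B.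
  - by apply: L2eq_sub; [exact: aeW|exact: U0].
have small g : Cc_infty g -> forall e : R, 0 < e -> \forall h \near 0^',
    (L2norm (fun x => flow a b c h g x - U h g x)%R <= (e * `|h|)%:E)%E.
  move=> Cg e e0; have e2 : 0 < e / 2 by rewrite divr_gt0.
  have Lg := Cc_infty_L2 Cg.
  have [_ _ /(cvge0P _ (fun=> L2norm_ge0 _)) cU] := gen _ Cg.
  have /(cvge0P _ (fun=> L2norm_ge0 _)) cF := flow_quotient_cvg a b c Cg.
  near=> h.
  have h0 : h != 0 by near: h; exact: nbhs_dnbhs_neq.
  have LiH : L2 (fun x => 'i%C * hamiltonian a b c g x).
    apply: Cc_infty_L2; apply: Cc_infty_mul; first exact: csmooth_cst.
    exact: hamiltonian_Cc.
  have mq u : L2 u -> cmeas (fun x => (h^-1)%:C * (u x - g x) - 'i%C * hamiltonian a b c g x).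
    move=> Lu; apply: cmeasB; last exact: L2_cmeas.
    by apply: cmeasM; [exact: cmeas_cst|apply: cmeasB; exact: L2_cmeas].
  (* Both difference quotients tend to the same limit i H g, which is subtracted from each; the
     factor h left in front gives the o(h). *)
  have E : (fun x => flow a b c h g x - U h g x) = (fun x => h%:C *
      (((h^-1)%:C * (flow a b c h g x - g x) - 'i%C * hamiltonian a b c g x) -
       ((h^-1)%:C * (U h g x - g x) - 'i%C * hamiltonian a b c g x))).
    apply/funext => x; rewrite opprB addrA subrK -mulrBr opprB addrA subrK mulrA.
    by rewrite -rmorphM mulfV// mul1r.
  rewrite E L2normZ; last by apply: cmeasB; apply: mq; [exact: Lflow|exact: LU].
  rewrite mulrC EFinM lee_pmul2l//; last by rewrite lte_fin normr_gt0.
  apply: le_trans (L2normB_le (mq _ (Lflow _ _ Cg)) (mq _ (LU _ _ Lg))) _.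
  rewrite (splitr e) EFinD; apply: leeD; near: h.
    exact: cF.
  exact: cU.
have dm r : is_derive r (1 : R) m 0.
  apply: is_derive_of_cvg; apply/cvgrPdist_le => e e0.
  pose g := flow a b c r f; have Cg : Cc_infty g by exact: flow_Cc.
  have Lg := Cc_infty_L2 Cg.
  near=> h.
  have h0 : h != 0 by near: h; exact: nbhs_dnbhs_neq.
  have He : (L2norm (fun x => flow a b c h g x - U h g x)%R <= (e * `|h|)%:E)%E.
    by near: h; exact: small.
  pose p := flow a b c h g; pose q := U h g; pose w := U (h + r) f.
  have [Lp Lq Lw] : [/\ L2 p, L2 q & L2 w] by split; [exact: Lflow|exact: LU|exact: LU].
  (* Applying [U h] to both vectors preserves their distance. Then [m r] and [m (h + r)] are the
     distances of [q] and [p] to the same vector [w], and differ by at most the distance of [p] and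
     [q]. *)
  have mE : m r = fine (L2norm (fun x => q x - w x)).
    rewrite /m -(unitary_L2norm (uU h)); last by apply: L2B => //; exact: LU.
    congr fine; apply: L2norm_ae.
    - by apply: L2_cmeas; apply: (LU); apply: L2B => //; exact: LU.
    - by apply: L2_cmeas; exact: L2B.
    apply: L2eq_trans (unitary_sub (uU h) Lg (LU _ _ Lf)) _.
    by apply: L2eq_sub; [exact: aeW|apply: L2eq_sym; exact: UD].
  have mhE : m (h + r) = fine (L2norm (fun x => p x - w x)).
    by rewrite /m (_ : flow a b c (h + r) f = p) // addrC flowD.
  rewrite sub0r normrN normrM normfV mulrC ler_pdivrMr ?normr_gt0//.
  rewrite ler_norml mE mhE; move: (L2_cmeas Lp) (L2_cmeas Lq) (L2_cmeas Lw) => mp mq mw.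
  have Fn (u v : R -> R[i]) : L2 u -> L2 v -> L2norm (fun x => u x - v x) \is a fin_num.
    by move=> Lu Lv; apply: L2norm_fin; exact: L2B.
  apply/andP; split.
    rewrite lerBrDl lerBlDr -lee_fin EFinD !fineK ?Fn//.
    apply: le_trans (L2norm_dist_le mq mw mp) _.
    by rewrite [leRHS]addeC; apply: leeD2r; rewrite L2normC.
  rewrite lerBlDr -lee_fin EFinD !fineK ?Fn//.
  apply: le_trans (L2norm_dist_le mp mw mq) _.
  exact: leeD2r.
have ms : m s = 0 by rewrite -m0; apply: is_derive_0_is_cst.
apply: L2eq_sym; apply: L2norm_eq0_L2eq.
- by apply: L2_cmeas; exact: Lflow.
- by apply: L2_cmeas; exact: LU.
- rewrite -[LHS]fineK -/(m s) ?ms//.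
  by apply: L2norm_fin; apply: L2B; [exact: Lflow|exact: LU].
Unshelve. all: by end_near. Qed.

End Uniqueness.

(** * Gaussian integrals and moments *)

Section Gaussian.
Context {R : realType}.
Local Notation mu := (@lebesgue_measure R).

Lemma integrable_normal_fun (m s : R) : s != 0 ->
  mu.-integrable setT (EFin \o normal_fun m s).
Proof.
move=> s0.
have p0 : normal_peak s != 0 by rewrite gt_eqF// normal_peak_gt0.
rewrite (_ : _ \o _ = fun x => ((normal_peak s)^-1%:E * (normal_pdf m s x)%:E)%E).
  by apply: integrableZl => //; exact: integrable_normal_pdf.
by apply/funext => x /=; rewrite normal_pdfE// -EFinM mulKf.
Qed.

(** The integrand is sqrt pi times the normal density with mean m and variance 1/2. *)
Lemma integral_gauss_shift (m : R) :
  (\int[mu]_x (expR (- (x - m) ^+ 2))%:E = (Num.sqrt pi)%:E)%E.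
Proof.
pose s : R := Num.sqrt 2^-1.
have s2 : s ^+ 2 = 2^-1 by rewrite sqr_sqrtr.
have s0 : s != 0 by rewrite gt_eqF// sqrtr_gt0 invr_gt0.
have peakE : normal_peak s = (Num.sqrt pi)^-1.
  by rewrite /normal_peak s2 -mulr_natr mulrAC mulVf ?mul1r.
have spi : Num.sqrt (pi : R) != 0 by rewrite gt_eqF// sqrtr_gt0 pi_gt0.
under eq_integral => x _.
  rewrite (_ : expR _ = Num.sqrt pi * normal_pdf m s x); last first.
    rewrite normal_pdfE// peakE mulrA mulfV// mul1r /normal_fun s2.
    by rewrite -[in RHS]mulr_natr mulVf// divr1.
  rewrite EFinM; over.
rewrite integralZl//=; first by rewrite integral_normal_pdf mule1.
exact: integrable_normal_pdf.
Qed.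

Lemma pow_le_expR (x : R) n : 0 <= x -> x ^+ n <= n`!%:R * expR x.
Proof.
move=> x0; case: n => [|n].
  by rewrite expr0 mul1r -[leLHS]expR0 ler_expR.
rewrite mulrC -ler_pdivrMr ?ltr0n ?fact_gt0//.
by apply: le_trans (expR_ge1Dxn n x0); rewrite lerDr.
Qed.

(** Half of the Gaussian absorbs the power, by |y|^n <= 1 + y^(2n) and (y^2/2)^n <= n! e^(y^2/2).
    The other half is left in the spelling of [normal_fun] with deviation 1, whose integrability is
    known. *)
Lemma pow_gauss_le (y : R) n :
  `|y| ^+ n * expR (- y ^+ 2) <= (1 + 2 ^+ n * n`!%:R) * expR (- y ^+ 2 / (1 ^+ 2 *+ 2)).
Proof.
have -> : expR (- y ^+ 2) = expR (- y ^+ 2 / (1 ^+ 2 *+ 2)) * expR (- y ^+ 2 / (1 ^+ 2 *+ 2)).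
  by rewrite -expRD; congr expR; field.
rewrite mulrA ler_pM2r ?expR_gt0//.
rewrite mulNr expRN ler_pdivrMr ?expR_gt0//.
rewrite expr1n.
have y2 : 0 <= y ^+ 2 / 2 by rewrite divr_ge0 ?sqr_ge0.
have H := pow_le_expR n y2.
have H1 : 1 <= expR (y ^+ 2 / 2) by rewrite -[leLHS]expR0 ler_expR.
have H2 : `|y| ^+ n <= 1 + (y ^+ 2) ^+ n.
  have [y1|y1] := leP `|y| 1.
    by apply: (@le_trans _ _ 1); [exact: exprn_ile1|rewrite lerDl exprn_ge0 ?sqr_ge0].
  have le1 : 1 <= `|y| ^+ n by apply: exprn_ege1; exact: ltW.
  rewrite -[y ^+ 2]real_normK ?num_real// -exprM mulnC exprM expr2.
  apply: (@le_trans _ _ (`|y| ^+ n * `|y| ^+ n)); last by rewrite lerDr.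
  by rewrite ler_peMr// (le_trans ler01).
apply: le_trans H2 _; rewrite mulrDl mul1r; apply: lerD => //.
rewrite -mulrA -ler_pdivrMl ?exprn_gt0// mulrC -exprVn -exprMn; exact: H.
Qed.

Lemma integrable_pow_gauss (m : R) n :
  mu.-integrable setT (fun x => (`|x - m| ^+ n * expR (- (x - m) ^+ 2))%:E).
Proof.
apply: (@le_integrable _ _ _ mu _ measurableT _
  (fun x => ((1 + 2 ^+ n * n`!%:R)%:E * (normal_fun m 1 x)%:E)%E)).
- apply/measurable_EFinP; apply: measurable_funM.
    apply: measurable_funX; apply: measurableT_comp => //.
    exact: measurable_funB.
  apply: measurableT_comp => //; apply: measurableT_comp => //.
  by apply: measurable_funX; exact: measurable_funB.
- move=> x _; rewrite -EFinM !abse_EFin lee_fin.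
  rewrite ger0_norm ?mulr_ge0 ?exprn_ge0 ?expR_ge0//.
  apply: le_trans (ler_norm _); exact: pow_gauss_le.
- by apply: integrableZl => //; exact: integrable_normal_fun.
Qed.

End Gaussian.

(** * The vacuum vector and its approximation in C_c^infty *)

Section Vacuum.
Context {R : realType}.
Local Notation mu := (@lebesgue_measure R).
Local Notation Phi := (@vacuum R).

Lemma vacuum_peak_sqr : ((pi : R) `^ (- 4^-1)) ^+ 2 = (Num.sqrt pi)^-1.
Proof.
rewrite -powR_mulrn ?powR_ge0// -powRrM mulNr powRN; congr (_^-1).
rewrite -powR12_sqrt ?pi_ge0//; congr (_ `^ _); by field.
Qed.

Lemma vacuum_csmooth : csmooth Phi.
Proof.
apply: csmooth_real; apply: smoothM; first exact: smooth_cst.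
apply: (@smooth_comp _ (@expR R)); first exact: smooth_expR.
apply: smoothN; apply: smoothM; last exact: smooth_cst.
by apply: smoothX; exact: smooth_id.
Qed.

Lemma normc_vacuum_sqr (x : R) :
  normc (Phi x) ^+ 2 = (Num.sqrt pi)^-1 * expR (- x ^+ 2).
Proof.
rewrite normc_real -[RHS]ger0_norm ?mulr_ge0 ?expR_ge0 ?invr_ge0//.
rewrite -normrX exprMn vacuum_peak_sqr -expRM_natl; congr `|_ * expR _|.
by field.
Qed.

Lemma integrable_vacuum_sqr (d : R) :
  mu.-integrable setT (fun x => (normc (Phi (x + d)) ^+ 2)%:E).
Proof.
rewrite (_ : (fun _ => _) = fun x => (((Num.sqrt pi)^-1)%:E *
    (`|x - (- d)| ^+ 0 * expR (- (x - (- d)) ^+ 2))%:E)%E).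
  by apply: integrableZl => //; exact: integrable_pow_gauss.
by apply/funext => x; rewrite normc_vacuum_sqr opprK expr0 mul1r EFinM.
Qed.

Lemma cmeas_shift (f : R -> R[i]) (d : R) : csmooth f -> cmeas (fun x => f (x + d)).
Proof.
move=> sf; apply: csmooth_cmeas; apply: csmooth_comp => //.
by apply: smoothD; [exact: smooth_id|exact: smooth_cst].
Qed.

Lemma vacuum_L2 : L2 Phi.
Proof.
apply/L2P; split; first exact: csmooth_cmeas vacuum_csmooth.
rewrite L2normE; apply: poweR_lty.
have := integrable_vacuum_sqr 0 => /integrableP[_].
apply: le_lt_trans; rewrite le_eqVlt; apply/orP; left; apply/eqP.
by apply: eq_integral => x _; rewrite addr0 gee0_abs// lee_fin sqr_ge0.
Qed.

(* The cutoffs need no plateau: pointwise convergence to 1 is enough. *)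
Definition cutoff (n : nat) (x : R) : R := bump_pow 0 (n.+1%:R - x ^+ 2 / n.+1%:R).

Lemma cutoff_itv n x : 0 <= cutoff n x <= 1.
Proof.
rewrite /cutoff /bump_pow; case: ifPn => [y0|_]; last by rewrite lexx ler01.
by rewrite expr0 mul1r expR_ge0 -[leRHS]expR0 ler_expR oppr_le0 invr_ge0 ltW.
Qed.

Lemma smooth_cutoff n : smooth (cutoff n).
Proof.
apply: (@smooth_comp _ (bump_pow 0)); first exact: smooth_bump_pow.
apply: smoothB; first exact: smooth_cst.
by apply: smoothM; [apply: smoothX; exact: smooth_id|exact: smooth_cst].
Qed.

Lemma cutoff_support n x : n.+1%:R < `|x| -> cutoff n x = 0.
Proof.
move=> nx; rewrite /cutoff /bump_pow ifF//; apply/negbTE; rewrite -leNgt subr_le0.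
rewrite ler_pdivlMr// -expr2 -[x ^+ 2]real_normK ?num_real//.
by rewrite ler_pXn2r ?nnegrE// ltW.
Qed.

(** With y = n+1 - x^2/(n+1), which tends to infinity, the cutoff is e^(-1/y) >= 1 - 1/y once y >
    0. *)
Lemma cutoff_cvg x : cutoff n x @[n --> \oo] --> (1 : R).
Proof.
apply/cvgrPdist_le => e e0; near=> n.
have [_ c1] := andP (cutoff_itv n x).
have N1 : (1 : R) <= n.+1%:R by rewrite ler1n.
have y0 : e^-1 <= n.+1%:R - x ^+ 2 / n.+1%:R.
  apply: (@le_trans _ _ (n.+1%:R - x ^+ 2)).
    rewrite lerBrDr; apply: (@le_trans _ _ n%:R); last by rewrite ler_nat.
    by near: n; exact: nbhs_infty_ger.
  by rewrite lerB// ler_pdivrMr ?ltr0n// ler_peMr ?sqr_ge0.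
have yp : 0 < n.+1%:R - x ^+ 2 / n.+1%:R by apply: lt_le_trans y0; rewrite invr_gt0.
rewrite ger0_norm ?subr_ge0// /cutoff /bump_pow yp expr0 mul1r.
rewrite lerBlDl -lerBlDr; apply: le_trans (expR_ge1Dx _); rewrite lerD2l lerN2.
by rewrite -[leRHS]invrK lef_pV2// posrE ?invr_gt0.
Unshelve. all: by end_near. Qed.

(** Dominated convergence with majorant |Phi|^2, translated by [d]. One sequence serves all shifts,
    because the flow translates the error and the unitary group does not. *)
Lemma vacuum_approx : exists u : nat -> R -> R[i], (forall n, Cc_infty (u n)) /\
  forall d : R, L2norm (fun x => u n (x + d) - Phi (x + d)) @[n --> \oo] --> 0%E.
Proof.
exists (fun n x => (cutoff n x)%:C * Phi x); split=> [n|d].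
  apply/Cc_inftyP; split.
    by apply: csmoothM vacuum_csmooth; apply: csmooth_real; exact: smooth_cutoff.
  by exists n.+1%:R => x /cutoff_support ->; rewrite mul0r.
pose u n x := (normc ((cutoff n (x + d))%:C * Phi (x + d) - Phi (x + d)) ^+ 2)%:E.
have uE n x : u n x = ((1 - cutoff n (x + d)) ^+ 2 * normc (Phi (x + d)) ^+ 2)%:E.
  rewrite /u -[X in _ - X]mul1r -mulrBl -rmorphB.
  rewrite complex.ComplexField.Normc.normcM normc_real exprMn.
  by rewrite real_normK ?num_real// -sqrrN opprB.
have cn n x : 0 <= 1 - cutoff n x <= 1.
  by have /andP[c0 c1] := cutoff_itv n x; rewrite subr_ge0 c1 lerBlDr lerDl.
have [] := @dominated_convergence _ _ _ mu setT measurableT u (fun=> 0%E)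
  (fun x => (normc (Phi (x + d)) ^+ 2)%:E).
- move=> n; apply/measurable_EFinP; apply: measurable_funX; apply: measurable_normc.
  apply: cmeasB; last exact: cmeas_shift vacuum_csmooth.
  apply: (@cmeas_shift (fun x => (cutoff n x)%:C * Phi x)).
  by apply: csmoothM vacuum_csmooth; apply: csmooth_real; exact: smooth_cutoff.
- exact: measurable_cst.
- apply: aeW => x _; under eq_fun do rewrite uE.
  apply: cvg_EFin; first exact: nearW.
  rewrite [X in _ --> X](_ : _ = (1 - 1) ^+ 2 * normc (Phi (x + d)) ^+ 2); last first.
    by rewrite subrr expr0n mul0r.
  apply: cvgMr_tmp; rewrite expr2; under eq_fun do rewrite expr2.
  by apply: cvgM; apply: cvgB; try exact: cvg_cst; exact: cutoff_cvg.
- exact: integrable_vacuum_sqr.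
- apply: aeW => x n _; rewrite uE abse_EFin lee_fin.
  rewrite ger0_norm; last by apply: mulr_ge0; exact: sqr_ge0.
  apply: ler_piMl; first exact: sqr_ge0.
  by have /andP[? ?] := cn n (x + d); exact: exprn_ile1.
move=> _ _; rewrite integral0 => H.
apply/(cvge0P _ (fun=> L2norm_ge0 _)) => e e0.
have u0 n : (0 <= \int[mu]_x u n x)%E by apply: integral_ge0 => x _; exact: sqr_ge0.
have /(cvge0P _ u0)/(_ (e ^+ 2)) := H.
rewrite exprn_gt0// => /(_ isT); apply: filterS => n un.
by apply: L2norm_integral_le; [exact: ltW|exact: un].
Qed.

(** Both evolutions agree on the approximants. The error of the group is bounded by unitarity, that
    of the flow by its modulus-one phase, which leaves a translate of the original error. *)
Lemma unitary_group_vacuum (a b c : R) (U : R -> operator R) (s : R) :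
  unitary_group U ->
  (forall g, Cc_infty g -> generator U (g, hamiltonian a b c g)) ->
  L2eq (U s Phi) (flow a b c s Phi).
Proof.
move=> uU gen; have [u [Cu cu]] := vacuum_approx.
have Us : unitary (U s) by case: uU.
have LU f : L2 f -> L2 (U s f) by case: Us => + _ _ _ _; apply.
have mflow f : csmooth f -> cmeas (flow a b c s f).
  move=> sf; apply: cmeasM; last exact: cmeas_shift.
  by apply: csmooth_cmeas; apply: csmooth_expc_i; exact: smooth_phase.
have mP : cmeas (flow a b c s Phi) by apply: mflow; exact: vacuum_csmooth.
have mU : cmeas (U s Phi) by apply: L2_cmeas; apply: (LU); exact: vacuum_L2.
apply: L2norm_eq0_L2eq => //; apply/eqP; rewrite eq_le L2norm_ge0 andbT.
apply/lee_addgt0Pr => e e0; rewrite add0e.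
have e2 : 0 < e / 2 by rewrite divr_gt0.
(* Shift 0 for the unitary group, shift c s for the flow. *)
have /(cvge0P _ (fun=> L2norm_ge0 _)) c1 := cu 0.
have /(cvge0P _ (fun=> L2norm_ge0 _)) c2 := cu (c * s).
near \oo => n.
have Lun := Cc_infty_L2 (Cu n).
have sun : csmooth (u n) by have /Cc_inftyP[] := Cu n.
apply: le_trans (L2norm_dist_le mU mP (L2_cmeas (LU _ Lun))) _.
rewrite (splitr e) EFinD; apply: leeD.
  rewrite (@L2norm_ae _ _ (U s (fun x => Phi x - u n x))).
  - rewrite unitary_L2norm//; last by apply: L2B => //; exact: vacuum_L2.
    rewrite L2normC; near: n; move: (c1 _ e2); apply: filterS => n.
    by under eq_fun do rewrite addr0.
  - by apply: cmeasB => //; apply: L2_cmeas; exact: LU.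
  - by apply: L2_cmeas; apply: LU; apply: L2B => //; exact: vacuum_L2.
  - by apply: L2eq_sym; apply: unitary_sub => //; exact: vacuum_L2.
rewrite (@L2norm_ae _ _ (fun x => flow a b c s (u n) x - flow a b c s Phi x)).
- rewrite (@eq_L2norm _ _ (fun x => u n (x + c * s) - Phi (x + c * s))).
    by near: n; exact: c2.
  by move=> x; rewrite flowB normc_flow.
- by apply: cmeasB => //; apply: L2_cmeas; exact: LU.
- by apply: cmeasB => //; exact: mflow.
- by apply: L2eq_sub; [exact: unitary_group_flow|exact: aeW].
Unshelve. all: by end_near. Qed.

End Vacuum.

(** * A Gaussian integral with quadratic phase *)

Section ComplexIntegral.
Context {R : realType}.
Local Notation mu := (@lebesgue_measure R).

(** On intervals centred at [m] the fundamental theorem leaves two boundary terms of size at most C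
    over the half-length; dominated convergence passes to the whole line. *)
Lemma integral_derivative0 (F f : R -> R) (m C : R) :
  (forall x : R, is_derive x 1 F (f x)) -> continuous f ->
  mu.-integrable setT (EFin \o f) -> (forall x, `|x - m| * `|F x| <= C) ->
  \int[mu]_x f x = 0.
Proof.
move=> dF cf intf bF.
pose I n : set R := `[m - n.+1%:R, m + n.+1%:R]%classic.
have FTC n : (\int[mu]_(x in I n) (f x)%:E = (F (m + n.+1%:R) - F (m - n.+1%:R))%:E)%E.
  have cF : continuous F by apply: is_derive_continuous => x; have [] := dF x.
  rewrite EFinB; apply: continuous_FTC2.
  - by rewrite ltrD2l -subr_gt0 opprK addr_gt0.
  - exact: continuous_subspaceT.
  - split; first by move=> x _; have [] := dF x.
    + by apply: cvg_at_right_filter; exact: cF.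
    + by apply: cvg_at_left_filter; exact: cF.
  - by move=> x _; exact: derive1_is.
have [] := @dominated_convergence _ _ _ mu setT measurableT
  (fun n => (EFin \o f) \_ (I n)) (EFin \o f) (fun x => `|(f x)%:E|%E).
- move=> n; apply/(measurable_restrictT _ _).1; first exact: measurable_itv.
  apply: measurable_funTS; apply/measurable_EFinP.
  exact: continuous_measurable_fun.
- by apply/measurable_EFinP; exact: continuous_measurable_fun.
- apply: aeW => x _; apply: cvg_near_cst; near=> n.
  rewrite /patch ifT//; apply/mem_set; rewrite /I /= in_itv /=.
  rewrite -ler_distl; apply: (@le_trans _ _ n%:R); last by rewrite ler_nat.
  by near: n; exact: nbhs_infty_ger.
- exact: integrable_abse.
- apply: aeW => x n _; rewrite /patch; case: ifPn => // _.
  by rewrite abse0.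
move=> _ _ H.
have H0 : (\int[mu]_x ((EFin \o f) \_ (I n)) x)%E @[n --> \oo] --> 0%E.
  under eq_fun do rewrite -integral_mkcond FTC.
  apply: cvg_EFin; first exact: nearW.
  apply/cvgr0Pnorm_le => e e0; near=> n.
  have N0 : (0 : R) < n.+1%:R by [].
  have b1 : `|F (m + n.+1%:R)| <= C / n.+1%:R.
    by rewrite ler_pdivlMr// mulrC; have := bF (m + n.+1%:R); rewrite addrC addKr gtr0_norm.
  have b2 : `|F (m - n.+1%:R)| <= C / n.+1%:R.
    by rewrite ler_pdivlMr// mulrC; have := bF (m - n.+1%:R); rewrite addrC addKr normrN gtr0_norm.
  apply: le_trans (ler_normB _ _) _; apply: le_trans (lerD b1 b2) _.
  rewrite -mulrDl ler_pdivrMr// -ler_pdivrMl//.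
  apply: (@le_trans _ _ n%:R); last by rewrite ler_nat.
  by near: n; exact: nbhs_infty_ger.
have := cvg_unique _ H H0; rewrite /Rintegral => -> //.
Unshelve. all: by end_near. Qed.

Definition cintegrable (f : R -> R[i]) :=
  mu.-integrable setT (fun x => (Re (f x))%:E) /\ mu.-integrable setT (fun x => (Im (f x))%:E).

Definition cint (f : R -> R[i]) : R[i] :=
  (\int[mu]_x Re (f x)) +i* (\int[mu]_x Im (f x)).

Lemma cintegrable_le (f : R -> R[i]) (u : R -> R) : cmeas f ->
  mu.-integrable setT (fun x => (u x)%:E) -> (forall x, normc (f x) <= u x) -> cintegrable f.
Proof.
move=> [mr mi] iu fu; split; apply: (@le_integrable _ _ _ mu _ measurableT _ _ _ _ iu);
  try exact/measurable_EFinP; move=> x _; rewrite !abse_EFin lee_fin;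
  apply: le_trans (ler_norm _); apply: le_trans (fu x); [exact: normc_Re|exact: normc_Im].
Qed.

Lemma cintegrableD f g : cintegrable f -> cintegrable g -> cintegrable (fun x => f x + g x).
Proof.
move=> [fr fi] [gr gi]; split.
  by under eq_fun do rewrite Re_add EFinD; exact: integrableD.
by under eq_fun do rewrite Im_add EFinD; exact: integrableD.
Qed.

Lemma cintegrableZ (z : R[i]) f : cintegrable f -> cintegrable (fun x => z * f x).
Proof.
move=> [fr fi]; split.
  under eq_fun do rewrite Re_mul EFinB !EFinM.
  by apply: integrableB => //; exact: integrableZl.
under eq_fun do rewrite Im_mul EFinD !EFinM.
by apply: integrableD => //; exact: integrableZl.
Qed.

Lemma cintD f g : cintegrable f -> cintegrable g ->
  cint (fun x => f x + g x) = cint f + cint g.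
Proof.
move=> [fr fi] [gr gi]; apply: complex_ext.
  by rewrite Re_add /=; under eq_Rintegral do rewrite Re_add; rewrite RintegralD.
by rewrite Im_add /=; under eq_Rintegral do rewrite Im_add; rewrite RintegralD.
Qed.

Lemma cintZ (z : R[i]) f : cintegrable f -> cint (fun x => z * f x) = z * cint f.
Proof.
move=> [fr fi].
have iZ (r : R) (u : R -> R) : mu.-integrable setT (fun x => (u x)%:E) ->
    mu.-integrable setT (EFin \o (fun x => r * u x)).
  by move=> iu; rewrite /comp; under eq_fun do rewrite EFinM; exact: integrableZl.
apply: complex_ext.
  rewrite Re_mul /=; under eq_Rintegral do rewrite Re_mul.
  by rewrite RintegralB ?RintegralZl//; exact: iZ.
rewrite Im_mul /=; under eq_Rintegral do rewrite Im_mul.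
by rewrite RintegralD ?RintegralZl//; exact: iZ.
Qed.

Lemma cint_derivative0 (F f : R -> R[i]) (m C : R) :
  (forall x, is_cderive F x (f x)) -> csmooth f -> cintegrable f ->
  (forall x, `|x - m| * normc (F x) <= C) -> cint f = 0.
Proof.
move=> dF [sr si] [fr fi] bF; apply: complex_ext => /=.
  apply: (@integral_derivative0 (fun x => Re (F x)) _ m C) => //.
  - by move=> x; have [] := dF x.
  - exact: smooth_continuous.
  - by move=> x; apply: le_trans (bF x); rewrite ler_wpM2l// normc_Re.
apply: (@integral_derivative0 (fun x => Im (F x)) _ m C) => //.
- by move=> x; have [] := dF x.
- exact: smooth_continuous.
- by move=> x; apply: le_trans (bF x); rewrite ler_wpM2l// normc_Im.
Qed.

Lemma cint_derive_under (f f' : R -> R -> R[i]) (G : R -> R) (s : R) :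
  (forall r x, is_cderive (f^~ x) r (f' r x)) -> (forall r, cintegrable (f r)) ->
  mu.-integrable setT (fun x => (G x)%:E) -> (forall r x, normc (f' r x) <= G x) ->
  is_cderive (fun r => cint (f r)) s (cint (f' s)).
Proof.
move=> df fi iG fG.
have G0 x : 0 <= G x by apply: le_trans (normc_ge0 _) (fG 0 x).
have under (h h' : R -> R -> R) : (forall r x : R, is_derive r 1 (h^~ x) (h' r x)) ->
    (forall r, mu.-integrable setT (fun x => (h r x)%:E)) ->
    (forall r x, `|h' r x| <= G x) ->
    is_derive s 1 (fun r => \int[mu]_x h r x) (\int[mu]_x h' s x).
  move=> dh ih bh.
  (* The domination is global in r, so any open interval around [s] would do. *)
  have Is : `]s - 1, s + 1[%classic s by rewrite /= in_itv /= ltrBlDr ltrDl ltr01.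
  have dE r x : partial1of2 h r x = h' r x.
    by rewrite /partial1of2; exact: derive1_is.
  have der := @derivable_under_integral R _ _ mu h setT measurableT _ _ _ Is
    (fun r _ => ih r) (fun r x _ _ => @ex_derive _ _ _ _ _ _ _ (dh r x)) G G0 iG _.
  have val := @differentiation_under_integral R _ _ mu h setT measurableT _ _ _ Is
    (fun r _ => ih r) (fun r x _ _ => @ex_derive _ _ _ _ _ _ _ (dh r x)) G G0 iG _.
  have bd (r x : R) : `]s - 1, s + 1[%classic r -> setT x -> `|partial1of2 h r x| <= G x.
    by move=> _ _; rewrite dE.
  split; first exact: der.
  rewrite -derive1E (val bd); apply: eq_Rintegral => x _; exact: dE.
split.
  apply: (under (fun r x => Re (f r x)) (fun r x => Re (f' r x))).
  - by move=> r x; have [] := df r x.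
  - by move=> r; have [] := fi r.
  - by move=> r x; apply: le_trans (fG r x); exact: normc_Re.
apply: (under (fun r x => Im (f r x)) (fun r x => Im (f' r x))).
- by move=> r x; have [] := df r x.
- by move=> r; have [] := fi r.
- by move=> r x; apply: le_trans (fG r x); exact: normc_Im.
Qed.

End ComplexIntegral.

(** * Moments of the oscillatory Gaussian and their differential equation *)

Section OscillatoryGaussian.
Context {R : realType} (m a b : R).
Local Notation mu := (@lebesgue_measure R).

(** The power k keeps the family closed under differentiation in x and in s, up to coefficients; k =
    0 is the integrand of J. *)
Definition osc (k : nat) (s x : R) : R[i] :=
  ((x - m) ^+ k * expR (- (x - m) ^+ 2))%:C *
  expc ('i%C * (s * (a * (x - m) ^+ 2 + b * (x - m)))%:C).

Definition oscint k s := cint (osc k s).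

(** With y = x - m the exponent of [osc] is - z y^2 + i s b y, where z is this number. *)
Definition oscz (s : R) : R[i] := 1 - 'i%C * (s * a)%:C.

Lemma normc_osc k s x : normc (osc k s x) = `|x - m| ^+ k * expR (- (x - m) ^+ 2).
Proof.
rewrite /osc complex.ComplexField.Normc.normcM normc_real normc_expc.
rewrite Re_mul /= mul0r mulr0 subr0 expR0 mulr1 normrM normrX.
by rewrite (ger0_norm (expR_ge0 _)).
Qed.

Lemma smooth_sub_cst : smooth (fun x : R => x - m).
Proof. by apply: smoothB; [exact: smooth_id|exact: smooth_cst]. Qed.

Lemma csmooth_osc k s : csmooth (osc k s).
Proof.
apply: csmoothM.
  apply: csmooth_real; apply: smoothM; first by apply: smoothX; exact: smooth_sub_cst.
  apply: (@smooth_comp _ (@expR R)); first exact: smooth_expR.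
  by apply: smoothN; apply: smoothX; exact: smooth_sub_cst.
apply: csmooth_expc_i; apply: smoothM; first exact: smooth_cst.
apply: smoothD; apply: smoothM.
- exact: smooth_cst.
- by apply: smoothX; exact: smooth_sub_cst.
- exact: smooth_cst.
- exact: smooth_sub_cst.
Qed.

Lemma cintegrable_osc k s : cintegrable (osc k s).
Proof.
apply: (cintegrable_le (csmooth_cmeas (csmooth_osc k s)) (integrable_pow_gauss m k)).
by move=> x; rewrite normc_osc.
Qed.

(** For k = 0 the term with [k.-1] has coefficient 0. *)
Lemma osc_derive_x k (s x : R) : is_cderive (osc k s) x
  (k%:R * osc k.-1 s x - 2 * oscz s * osc k.+1 s x + 'i%C * (s * b)%:C * osc k s x).
Proof.
have d1 : is_derive x 1 (fun y => y - m) 1.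
  by apply: is_derive_eq (derive_sub (derive_var x) (derive_const m x)) _; rewrite subr0.
have c1 r := derive_const r x.
have dpow := derive_mul (derive_pow k d1)
   (@derive_chain _ expR (fun y => - (y - m) ^+ 2) _ _ _ (is_derive_expR _)
     (derive_opp (derive_pow 2 d1))).
have dph := derive_mul (c1 s) (derive_add (derive_mul (c1 a) (derive_pow 2 d1))
   (derive_mul (c1 b) d1)).
apply: is_cderive_eq (cderiveM (cderive_real dpow)
  (cderive_expc (cderiveM (cderive_cst 'i%C x) (cderive_real dph)))) _.
rewrite /osc /oscz.
set y := x - m; set e := expR _; set ph := expc _.
rewrite /= mulr1 !rmorphD !rmorphM !rmorphN !rmorphXn /= !exprS.
by rewrite !rmorphM /= !rmorph_nat; ring.
Qed.

Lemma osc_bound k s x : `|x - m| * normc (osc k s x) <= 1 + 2 ^+ k.+1 * (k.+1)`!%:R.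
Proof.
rewrite normc_osc mulrA -exprS; apply: le_trans (pow_gauss_le _ _) _.
apply: ler_piMr; first by rewrite addr_ge0// mulr_ge0// exprn_ge0.
rewrite -[leRHS]expR0 ler_expR mulNr oppr_le0 expr1n.
by rewrite divr_ge0 ?sqr_ge0.
Qed.

(* The integral over R of the x-derivative of [osc k s] vanishes. *)
Lemma oscint_parts k s :
  k%:R * oscint k.-1 s - 2 * oscz s * oscint k.+1 s + 'i%C * (s * b)%:C * oscint k s = 0.
Proof.
have i0 j := cintegrable_osc j s.
rewrite -(cint_derivative0 (osc_derive_x k s) _ _ (@osc_bound k s)).
- have iZ (z : R[i]) j : cintegrable (fun x => z * osc j s x) by exact: cintegrableZ.
  rewrite -mulNr /oscint -!cintZ// -!cintD//; last exact: cintegrableD.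
  by congr cint; apply/funext => x; rewrite mulNr.
- have sm (z : R[i]) j : csmooth (fun x => z * osc j s x).
    by apply: csmoothM; [exact: csmooth_cst|exact: csmooth_osc].
  under eq_fun do rewrite -mulNr.
  by apply: csmoothD => //; apply: csmoothD.
- under eq_fun do rewrite -mulNr.
  by apply: cintegrableD; [apply: cintegrableD|]; exact: cintegrableZ.
Qed.

Lemma osc_derive_s k (s x : R) : is_cderive (osc k ^~ x) s
  ('i%C * (a%:C * osc k.+2 s x + b%:C * osc k.+1 s x)).
Proof.
apply: is_cderive_eq (cderiveM (cderive_cst _ s) (cderive_expc (cderiveM (cderive_cst 'i%C s)
  (cderive_real (derive_mul (derive_var s) (derive_const _ s)))))) _.
rewrite /osc; set y := x - m; set e := expR _; set ph := expc _.
by rewrite mulr0 addr0 mul1r !rmorphD !rmorphM !rmorphXn /= !exprS; ring.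
Qed.

Lemma oscint_derive (s : R) : is_cderive (oscint 0) s
  ('i%C * (a%:C * oscint 2 s + b%:C * oscint 1 s)).
Proof.
have i0 j r := cintegrable_osc j r.
have -> : 'i%C * (a%:C * oscint 2 s + b%:C * oscint 1 s) =
    cint (fun x => 'i%C * (a%:C * osc 2 s x + b%:C * osc 1 s x)).
  rewrite cintZ; last by apply: cintegrableD; exact: cintegrableZ.
  by rewrite cintD ?cintZ//; exact: cintegrableZ.
apply: (@cint_derive_under _ (osc 0) (fun r x => 'i%C * (a%:C * osc 2 r x + b%:C * osc 1 r x))
  (fun x => `|a| * (`|x - m| ^+ 2 * expR (- (x - m) ^+ 2)) +
            `|b| * (`|x - m| ^+ 1 * expR (- (x - m) ^+ 2)))) => //.
- by move=> r x; exact: osc_derive_s.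
- under eq_fun do rewrite EFinD (EFinM `|a|) (EFinM `|b|).
  by apply: integrableD => //; apply: integrableZl => //; exact: integrable_pow_gauss.
- move=> r x; rewrite complex.ComplexField.Normc.normcM.
  have -> : normc ('i%C : R[i]) = 1 by rewrite normcE2 /= expr0n expr1n add0r sqrtr1.
  rewrite mul1r; apply: le_trans (le_normcD _ _) _.
  by rewrite (complex.ComplexField.Normc.normcM a%:C) (complex.ComplexField.Normc.normcM b%:C)
    !normc_real !normc_osc.
Qed.

Lemma Re_oscz s : Re (oscz s) = 1.
Proof. by rewrite /oscz Re_sub Re_mul /=; ring. Qed.

Lemma oscz_neq0 s : oscz s != 0.
Proof.
apply/eqP => /(congr1 (fun z => Re z)); rewrite Re_oscz => /eqP.
by rewrite oner_eq0.
Qed.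

(** The derivative in s involves the moments 1 and 2. Integration by parts for k = 0 and k = 1
    expresses both through the moment 0, at the price of dividing by 2 z. *)
Lemma oscint_ode (s : R) : is_cderive (oscint 0) s
  (('i%C * a%:C / (2 * oscz s) - 'i%C * a%:C * (s * b)%:C ^+ 2 / (4 * oscz s ^+ 2) -
    b%:C * (s * b)%:C / (2 * oscz s)) * oscint 0 s).
Proof.
have z0 := oscz_neq0 s.
have i2 : 'i%C ^+ 2 = -1 :> R[i] by exact: sqr_i.
apply: is_cderive_eq (oscint_derive s) _.
have P0 := oscint_parts 0 s; have P1 := oscint_parts 1 s.
rewrite /= mul0r sub0r in P0; rewrite /= mul1r in P1.
have E1 : oscint 1 s = 'i%C * (s * b)%:C * oscint 0 s / (2 * oscz s).
  apply: (mulfI (mulf_neq0 _ z0 : 2 * oscz s != 0)); first by rewrite pnatr_eq0.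
  rewrite [RHS]mulrC mulfVK ?mulf_neq0 ?pnatr_eq0//.
  by apply/esym/eqP; rewrite -subr_eq0 addrC P0.
have E2 : oscint 2 s = (oscint 0 s + 'i%C * (s * b)%:C * oscint 1 s) / (2 * oscz s).
  apply: (mulfI (mulf_neq0 _ z0 : 2 * oscz s != 0)); first by rewrite pnatr_eq0.
  rewrite [RHS]mulrC mulfVK ?mulf_neq0 ?pnatr_eq0//.
  by apply/esym/eqP; rewrite -subr_eq0 addrAC P1.
rewrite E2 E1.
(* These two rewrites spend i^2 = -1; what remains is an identity with ['i] as an indeterminate,
   within reach of [field]. *)
have -> : ((s * b)%:C ^+ 2 : R[i]) = - ('i%C * (s * b)%:C) ^+ 2.
  by rewrite exprMn i2 mulN1r opprK.
have -> : - (b%:C * (s * b)%:C / (2 * oscz s)) =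
    'i%C * b%:C * ('i%C * (s * b)%:C) / (2 * oscz s).
  by rewrite mulrACA -expr2 i2 mulN1r mulNr.
by field.
Qed.

End OscillatoryGaussian.

(** * Integrals of functions equal almost everywhere *)

Section AlmostEverywhere.
Context {R : realType}.
Local Notation mu := (@lebesgue_measure R).
Import HBNNSimple.

(* Neither function is assumed measurable, hence the detour through the
   definition of the integral as a supremum over simple functions. *)
Lemma ae_eq_integralT (f g : R -> \bar R) :
  {ae mu, forall x, f x = g x} -> (\int[mu]_x f x = \int[mu]_x g x)%E.
Proof.
have le (u v : R -> \bar R) : (forall x, 0 <= u x)%E -> (forall x, 0 <= v x)%E ->
    {ae mu, forall x, u x = v x} -> (\int[mu]_x u x <= \int[mu]_x v x)%E.
  move=> u0 v0 [N [mN N0 subN]]; rewrite !ge0_integralTE//.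
  apply: ge_ereal_sup => _ /= [h hu <-].
  (* The simple function below [u] is cut to 0 on the null set: it falls below [v] and keeps its
     integral. *)
  apply: ereal_sup_ubound => /=; exists (proj_nnsfun h (measurableC mN)).
    move=> x; rewrite /= mindicE; case: (boolP (x \in ~` N)) => [|_]; last by rewrite mulr0.
    rewrite inE mulr1 => xN; apply: le_trans (hu x) _.
    by rewrite (_ : u x = v x)//; apply: contrapT => /subN.
  rewrite -!integralT_nnsfun; apply: ge0_ae_eq_integral => //.
  - exact/measurable_EFinP.
  - exact/measurable_EFinP.
  - by move=> x _; rewrite lee_fin fun_ge0.
  - by move=> x _; rewrite lee_fin fun_ge0.
  exists N; split=> // x /= H; apply: contrapT => xN; apply: H => _.
  by rewrite mindicE mem_set// mulr1.
have eq (u v : R -> \bar R) : (forall x, 0 <= u x)%E -> (forall x, 0 <= v x)%E ->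
    {ae mu, forall x, u x = v x} -> (\int[mu]_x u x = \int[mu]_x v x)%E.
  move=> u0 v0 uv; apply/eqP; rewrite eq_le !le//.
  by apply: (@filterS _ _ (ae_filter_ringOfSetsType mu)) uv => x.
move=> fg; rewrite integralE [RHS]integralE; congr (_ - _)%E; apply: eq => //;
  apply: (@filterS _ _ (ae_filter_ringOfSetsType mu)) fg => x E.
- by rewrite !funeposE E.
- by rewrite !funenegE E.
Qed.

(** [is_expi] fixes [W] of the vacuum only almost everywhere, with no measurability of that
    representative. *)
Lemma inner_L2eq (f g g' : R -> R[i]) : L2eq g g' -> inner f g = inner f g'.
Proof.
rewrite /L2eq => gg; rewrite /inner /Rintegral.
by congr (fine _ +i* fine _); apply: ae_eq_integralT;
  apply: (@filterS _ _ (ae_filter_ringOfSetsType mu)) gg => x ->.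
Qed.

End AlmostEverywhere.

(** * Closed form of the oscillatory integral and its branch *)

Section OscillatoryGaussianValue.
Context {R : realType}.
Local Notation mu := (@lebesgue_measure R).

Lemma cderiveV (f : R -> R[i]) (x : R) (l : R[i]) : f x != 0 -> is_cderive f x l ->
  is_cderive (fun y => (f y)^-1) x (- l / f x ^+ 2).
Proof.
move=> fx0 [fr fi].
have n0 : Re (f x) ^+ 2 + Im (f x) ^+ 2 != 0.
  apply: contra fx0; rewrite paddr_eq0 ?sqr_ge0// !sqrf_eq0 => /andP[/eqP r0 /eqP i0].
  by apply/eqP; apply: complex_ext.
have dn := @is_deriveV _ (fun y => Re (f y) ^+ 2 + Im (f y) ^+ 2) x _ _ n0
  (derive_add (derive_pow 2 fr) (derive_pow 2 fi)).
have n0' : Im (f x) ^+ 2 + Re (f x) ^+ 2 != 0 by rewrite addrC.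
have E : - l / f x ^+ 2 = ((Re (f x) ^+ 2 + Im (f x) ^+ 2) ^- 2)%:C * (- l * conjc (f x) ^+ 2).
  have N : f x * conjc (f x) = (Re (f x) ^+ 2 + Im (f x) ^+ 2)%:C.
    by apply: complex_ext; case: (f x) => p q /=; ring.
  have c0 : conjc (f x) != 0 by rewrite conjc_eq0.
  rewrite fmorphV rmorphXn /= -N.
  by field; rewrite fx0 c0.
have RV (z : R[i]) : Re z^-1 = Re z * (Re z ^+ 2 + Im z ^+ 2)^-1 by case: z.
have IV (z : R[i]) : Im z^-1 = - (Im z * (Re z ^+ 2 + Im z ^+ 2)^-1) by case: z.
rewrite E; split.
  under eq_fun do rewrite RV.
  apply: is_derive_eq (derive_mul fr dn) _.
  rewrite Re_scale /GRing.scale /=; move: n0 n0'.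
  case: (f x) => p q /= n0 n0'; case: l {fr fi dn E} => u v /=.
  by field.
under eq_fun do rewrite IV.
apply: is_derive_eq (derive_opp (derive_mul fi dn)) _.
rewrite Im_scale /GRing.scale /=; move: n0 n0'.
  case: (f x) => p q /= n0 n0'; case: l {fr fi dn E} => u v /=.
by field.
Qed.

Lemma cderive_continuous_Re (f : R -> R[i]) (f' : R -> R[i]) :
  (forall x, is_cderive f x (f' x)) -> continuous (fun x => Re (f x)).
Proof. by move=> df; apply: is_derive_continuous => x; have [[]] := df x. Qed.

Lemma cderive0_cst (f : R -> R[i]) x y : (forall s, is_cderive f s 0) -> f x = f y.
Proof.
move=> df; apply: complex_ext.
  by apply: (@is_derive_0_is_cst _ (fun s => Re (f s))) => s; have [] := df s.
by apply: (@is_derive_0_is_cst _ (fun s => Im (f s))) => s; have [] := df s.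
Qed.

Lemma Re_sqrtc_gt0 (z : R[i]) : 0 < Re z -> 0 < Re (sqrtc z).
Proof.
by case: z => p q /= p0; rewrite sqrtr_gt0 divr_gt0// ltr_wpDl ?sqrtr_ge0.
Qed.

Section Solution.
Context (m a b : R).
Local Notation J := (oscint m a b 0).
Local Notation z := (oscz a).

(** Completing the square in - z y^2 + i s b y leaves the constant - s^2 b^2 / (4 z), of which this
    is the negative. *)
Definition osc_exponent (s : R) : R[i] := (s * b)%:C ^+ 2 / (4 * z s).

Lemma oscz_derive (s : R) : is_cderive z s (- ('i%C * a%:C)).
Proof.
have da : is_derive s 1 (fun r => r * a) a.
  apply: is_derive_eq (derive_mul (derive_var s) (derive_const a s)) _.
  by rewrite mul1r mulr0 addr0.
rewrite /oscz; under eq_fun do rewrite -mulNr.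
apply: is_cderive_eq (cderiveD (cderive_cst 1 s)
  (cderiveM (cderive_cst (- 'i%C) s) (cderive_real da))) _.
by rewrite mul0r !add0r mulNr.
Qed.

Lemma osc_exponent_derive (s : R) : is_cderive osc_exponent s
  (2 * b%:C * (s * b)%:C / (4 * z s) + (s * b)%:C ^+ 2 * ('i%C * a%:C) / (4 * z s ^+ 2)).
Proof.
have z0 := oscz_neq0 a s.
have db : is_derive s 1 (fun r => r * b) b.
  apply: is_derive_eq (derive_mul (derive_var s) (derive_const b s)) _.
  by rewrite mul1r mulr0 addr0.
have dc := cderive_real db.
rewrite (_ : osc_exponent = fun r => (4^-1 * ((r * b)%:C * (r * b)%:C)) * (z r)^-1); last first.
  by apply/funext => r; rewrite /osc_exponent; have := oscz_neq0 a r => zr; field.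
apply: is_cderive_eq (cderiveM (cderiveM (cderive_cst (4^-1) s) (cderiveM dc dc))
  (cderiveV z0 (oscz_derive s))) _.
by field.
Qed.

(* [osc_core s] is a square root of pi / z; its real part never vanishes, because
   Re z = 1, so by continuity it stays on the branch of [sqrt pi / sqrtc z]. *)
Definition osc_core (s : R) : R[i] := J s * expc (osc_exponent s).

(** The exponential is an integrating factor: it cancels every term of the equation for J that
    contains b. *)
Lemma osc_core_derive (s : R) : is_cderive osc_core s ('i%C * a%:C / (2 * z s) * osc_core s).
Proof.
have z0 := oscz_neq0 a s.
apply: is_cderive_eq (cderiveM (oscint_ode m a b s) (cderive_expc (osc_exponent_derive s))) _.
rewrite /osc_core; set e := expc _; set j := oscint _ _ _ _ _.
by field.
Qed.

Lemma oscint0 : J 0 = (Num.sqrt pi)%:C.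
Proof.
have E : osc m a b 0 0 = fun x => (expR (- (x - m) ^+ 2))%:C.
  by apply/funext => x; rewrite /osc expr0 mul1r mul0r mulr0 expc0 mulr1.
rewrite /oscint E; apply: complex_ext; rewrite /= /Rintegral.
  by rewrite integral_gauss_shift.
by rewrite integral0.
Qed.

(** The logarithmic derivatives i a / z of the square and - i a / z of z cancel, so the product
    keeps its value at s = 0. *)
Lemma osc_core_sqr s : osc_core s ^+ 2 * z s = pi%:C.
Proof.
have -> : osc_core s ^+ 2 * z s = osc_core 0 ^+ 2 * z 0.
  apply: (@cderive0_cst (fun r => osc_core r ^+ 2 * z r)) => r.
  have z0 := oscz_neq0 a r.
  under eq_fun do rewrite expr2.
  apply: is_cderive_eq (cderiveM (cderiveM (osc_core_derive r) (osc_core_derive r))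
    (oscz_derive r)) _.
  by field.
rewrite /osc_core /osc_exponent oscint0 mul0r expr0n mul0r expc0 mulr1.
by rewrite /oscz mul0r mulr0 subr0 mulr1 -rmorphXn /= sqr_sqrtr// pi_ge0.
Qed.

Lemma Re_osc_core_gt0 s : 0 < Re (osc_core s).
Proof.
(* If k is purely imaginary, k^2 = - (Im k)^2 is real and Re (k^2 z) = - (Im k)^2, which cannot be
   pi. *)
have nz r : Re (osc_core r) != 0.
  apply/negP => /eqP; move: (osc_core r) (osc_core_sqr r) => k kz k0.
  have := congr1 (fun w => Re w) kz; rewrite Re_mul expr2 Re_mul Im_mul k0 Re_oscz.
  move=> H; have {}H : (pi : R) = - Im k ^+ 2 by move: H => /= <-; ring.
  by have := pi_gt0 R; rewrite H oppr_gt0 ltNge sqr_ge0.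
have c0 : 0 < Re (osc_core 0).
  rewrite /osc_core /osc_exponent oscint0 mul0r expr0n mul0r expc0 mulr1 /=.
  by rewrite sqrtr_gt0 pi_gt0.
rewrite ltNge; apply/negP => sle.
have cK A : {within A, continuous (fun r => Re (osc_core r))}.
  by apply: continuous_subspaceT; exact: cderive_continuous_Re osc_core_derive.
have [s0|s0] := leP 0 s.
  have [|r _ /eqP] := IVT (v := 0) s0 (cK _); last by rewrite (negbTE (nz r)).
  by rewrite ge_min le_max sle (ltW c0) orbT.
have [|r _ /eqP] := IVT (v := 0) (ltW s0) (cK _); last by rewrite (negbTE (nz r)).
by rewrite ge_min le_max sle (ltW c0) orbT.
Qed.

Lemma oscint_value s :
  J s = (Num.sqrt pi)%:C / sqrtc (z s) * expc (- osc_exponent s).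
Proof.
have zp : 0 < Re (sqrtc (z s)) by apply: Re_sqrtc_gt0; rewrite Re_oscz.
have z0 : sqrtc (z s) != 0 by rewrite sqrtc_eq0 oscz_neq0.
have sp : 0 < Num.sqrt (pi : R) by rewrite sqrtr_gt0 pi_gt0.
suff H : osc_core s = (Num.sqrt pi)%:C / sqrtc (z s).
  by rewrite -H /osc_core -mulrA -expcD subrr expc0 mulr1.
apply: (mulIf z0); rewrite divfK//.
have : (osc_core s * sqrtc (z s)) ^+ 2 == (Num.sqrt pi)%:C ^+ 2.
  by rewrite exprMn sqr_sqrtc osc_core_sqr -rmorphXn /= sqr_sqrtr// pi_ge0.
rewrite eqf_sqr => /orP[/eqP //|/eqP neg].
(* With the wrong sign the core would be a negative multiple of the conjugate of [sqrtc (z s)],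
   hence of negative or zero real part. *)
have : osc_core s = (- (Num.sqrt pi / normc (sqrtc (z s)) ^+ 2))%:C * conjc (sqrtc (z s)).
  have N : sqrtc (z s) * conjc (sqrtc (z s)) = (normc (sqrtc (z s)) ^+ 2)%:C.
    by rewrite sqr_normcE; apply: complex_ext; case: (sqrtc _) => p q /=; ring.
  have n0 : (normc (sqrtc (z s)) ^+ 2)%:C != 0 :> R[i].
    by rewrite -N mulf_neq0// conjc_eq0.
  apply: (mulIf z0); rewrite neg -mulrA [conjc _ * _]mulrC N.
  by rewrite -rmorphM -rmorphN mulNr divfK//; apply: contra n0 => /eqP ->.
move=> /(congr1 (fun w => Re w)); rewrite Re_scale => H.
have := Re_osc_core_gt0 s; rewrite H mulNr oppr_gt0 ltNge mulr_ge0//.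
  by rewrite divr_ge0 ?sqrtr_ge0 ?sqr_ge0.
by case: (sqrtc _) zp => p q /= /ltW.
Qed.

End Solution.

End OscillatoryGaussianValue.

(** * The vacuum expectation *)

Section VacuumExpectation.
Context {R : realType}.

Lemma quadratic_opE (A B C t : R) (f : R -> R[i]) :
  scaleop t (quadratic_op A B C) f =
  hamiltonian (2 * t * A) (Num.sqrt 2 * t * B) (Num.sqrt 2 * t * C) f.
Proof.
have s2 : (Num.sqrt 2)%:C * (Num.sqrt 2)%:C = 2 :> R[i].
  by rewrite -rmorphM -expr2 sqr_sqrtr// rmorph_nat.
apply/funext => x.
rewrite /scaleop /quadratic_op /addop /scaleop /sqrt2q /sqrt2p /scaleop /position /=.
rewrite /hamiltonian !rmorphD !rmorphM /= rmorph_nat -s2.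
by ring.
Qed.

Lemma graph_sub_closure (D : set (R -> R[i])) (T : operator R) (f : R -> R[i]) :
  L2 f -> L2 (T f) -> D f -> closure_graph D T (f, T f).
Proof.
move=> Lf LT Df; split=> //; exists (fun=> f).
by split=> //; rewrite L2norm_subrr; exact: cvg_cst.
Qed.

(** The point x + c/2 is the mean of the path x + c u for u in [0, 1], and c^2/12 is its variance,
    whence the constant a c^2/12 in the phase. The same midpoint centres Phi(x) Phi(x + c), with the
    factor e^(-c^2/4), and the sqrt pi of the integral cancels the normalisation. *)
Lemma inner_vacuum_flow (a b c : R) :
  inner (@vacuum R) (flow a b c 1 (@vacuum R)) =
  (sqrtc (oscz a 1))^-1 *
  expc ((- (c ^+ 2 / 4))%:C + 'i%C * (a * c ^+ 2 / 12)%:C - osc_exponent a b 1).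
Proof.
pose k := ((Num.sqrt pi)^-1 * expR (- (c ^+ 2 / 4)))%:C * expc ('i%C * (a * c ^+ 2 / 12)%:C).
have E x : conjc (@vacuum R x) * flow a b c 1 (@vacuum R) x = k * osc (- (c / 2)) a b 0 1 x.
  rewrite /vacuum conjc_real /flow /osc expr0 !mul1r opprK mulr1.
  have -> : phase a b c 1 x =
      a * c ^+ 2 / 12 + (a * (x + c / 2) ^+ 2 + b * (x + c / 2)).
    by rewrite /phase; field.
  rewrite rmorphD mulrDr expcD /k -vacuum_peak_sqr.
  (* One Gaussian factor is written as a quotient by the other, which then cancels. *)
  have -> : expR (- (x ^+ 2 / 2)) = expR (- (c ^+ 2 / 4)) * expR (- (x + c / 2) ^+ 2) /
      expR (- ((x + c) ^+ 2 / 2)).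
    by rewrite -expRN -!expRD; congr expR; field.
  have e0 : (expR (- ((x + c) ^+ 2 / 2)))%:C != 0 :> R[i].
    by rewrite eq_complex /= gt_eqF// expR_gt0.
  by rewrite !rmorphM /= fmorphV; field.
have -> : inner (@vacuum R) (flow a b c 1 (@vacuum R)) =
    cint (fun x => k * osc (- (c / 2)) a b 0 1 x).
  by rewrite /inner /cint; congr (_ +i* _); apply: eq_Rintegral => x _; rewrite E.
rewrite cintZ ?oscint_value; last exact: cintegrable_osc.
rewrite -/(oscint _ _ _ _ _) oscint_value /k !expcD expc_real rmorphM fmorphV /=.
have sp : (Num.sqrt pi)%:C != 0 :> R[i].
  by rewrite eq_complex /= gt_eqF// sqrtr_gt0 pi_gt0.
have z0 : sqrtc (oscz a 1) != 0 by rewrite sqrtc_eq0 oscz_neq0.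
by field; rewrite sp z0.
Qed.

End VacuumExpectation.

(* [sqrtc] is the principal branch: nonnegative real part, sqrtc (-1) = 'i. *)
Theorem theorem2 (R : realType) (A B C t : R) (W : operator R) :
  is_expi (closure_graph (@Cc_infty R) (scaleop t (quadratic_op A B C))) W ->
  let M : R[i] := B +i* C in
  inner (@vacuum R) (W (@vacuum R)) =
    (sqrtc (1 - 2 * 'i%C * t%:C * A%:C))^-1 *
    expc ((4 * C%:C ^+ 2 * (A%:C ^+ 2 * t%:C ^+ 4 + 2 * 'i%C * A%:C * t%:C ^+ 3)
           - 3 * `|M| ^+ 2 * t%:C ^+ 2)
          / (6 * (1 - 2 * 'i%C * A%:C * t%:C))).
Proof.
move=> [U [uU genU WU]] M.
pose a := 2 * t * A; pose b := Num.sqrt 2 * t * B; pose c := Num.sqrt 2 * t * C.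
have gen g : Cc_infty g -> generator U (g, hamiltonian a b c g).
  move=> Cg; rewrite genU -quadratic_opE; apply: graph_sub_closure => //.
    exact: Cc_infty_L2.
  by rewrite quadratic_opE; apply: Cc_infty_L2; exact: hamiltonian_Cc.
have WE : L2eq (W (@vacuum R)) (flow a b c 1 (@vacuum R)).
  apply: L2eq_trans (WU _ vacuum_L2) _; exact: unitary_group_vacuum.
rewrite (inner_L2eq _ WE) inner_vacuum_flow.
have zE : oscz a 1 = 1 - 2 * 'i%C * t%:C * A%:C.
  by rewrite /oscz /a mul1r !rmorphM rmorph_nat; ring.
have z0 := oscz_neq0 a 1; rewrite zE in z0.
rewrite /osc_exponent zE; congr (_ * expc _).
have s2 : Num.sqrt 2 ^+ 2 = 2 :> R by rewrite sqr_sqrtr.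
have b2 : (1 * b)%:C ^+ 2 = 2 * t%:C ^+ 2 * B%:C ^+ 2 :> R[i].
  by rewrite mul1r -rmorphXn /b !exprMn s2 !rmorphM /= rmorph_nat; ring.
have c2 : c ^+ 2 = 2 * t ^+ 2 * C ^+ 2 by rewrite /c !exprMn s2.
(* The t^4 term arises as a product of two factors i A; with this form of A^2 the final identity
   holds with ['i] as an indeterminate. *)
have A2 : A%:C ^+ 2 = - ('i%C * A%:C) ^+ 2 :> R[i] by rewrite exprMn sqr_i mulN1r opprK.
rewrite -add_Re2_Im2 b2 c2 A2 /a /= .
rewrite rmorphN !fmorph_div !rmorphM !rmorph_nat rmorphD !rmorphM /=.
have z0' : 1 - 2 * 'i%C * A%:C * t%:C != 0 :> R[i] by rewrite mulrAC.
by field; exact: z0'.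
Qed.
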